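(* Let $\phi=\tilde p/p$ be a rational inner function on $\mathbb{D}^2$ with a singularity at $\tau\in\mathbb{T}^2$. If $\tau$ is a $B^J$ point of $\phi$ (for a positive integer $J$), then $\max\{K_1,K_2\}\ge 2J$, where $K_i$ is the $z_i$-contact order of $\phi$.
   Context: $\phi=\tilde p/p$ where $p\in\mathbb{C}[z_1,z_2]$ has bidegree $(m,n)$, no zeros in $\mathbb{D}^2$, is atoral, and $\tilde p(z)=z_1^mz_2^n\overline{p(1/\bar z_1,1/\bar z_2)}$; a singularity is a zero of $p$ on $\mathbb{T}^2$. Contact orders: for $\zeta_2\in\mathbb{T}$ not the $z_2$-coordinate of a singularity, $\epsilon(\phi,\zeta_2)=\min\{1-|z_1|:\tilde p(z_1,\zeta_2)=0\}$ ($=0$ otherwise); for each $z_2$-coordinate $\tau_2$ of a singularity there is a rational $K>0$ with $\epsilon(\phi,\zeta_2)\approx|\tau_2-\zeta_2|^K$ near $\tau_2$, and $K_1$ is the maximum such $K$; $K_2$ is defined symmetrically. $B^J$ points: let $\Pi$ be the upper half plane, $\tilde\beta(w)=\frac{1+iw}{1-iw}$, and for $\tau=(\tau_1,\tau_2)\in\mathbb{T}^2$ let $g_\tau(w)=i\,\frac{1-\phi(\tau_1\tilde\beta(w_1),\tau_2\tilde\beta(w_2))}{1+\phi(\tau_1\tilde\beta(w_1),\tau_2\tilde\beta(w_2))}$ for $w\in\Pi^2$. Then $\tau$ is a $B^J$ point of $\phi$ if $\lim_{s\to0^+}|g_\tau(is,is)|=0$ and there are real numbers $\{\rho_j\}_{|j|\le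 2J-2}$, $j=(j_1,j_2)\in\mathbb{N}^2$, $|j|=j_1+j_2$, such that $g_\tau(w)=\sum_{|j|\le2J-2}\rho_jw^j+O(\|w\|^{2J-1})$ non-tangentially, meaning: for each $c>0$ this holds for all sufficiently small $w\in\Pi^2$ with $\|1/w\|\le c\min\{-\mathrm{Im}(1/w_1),-\mathrm{Im}(1/w_2)\}$. *)

(* Defs.v *)
From Stdlib Require Import Reals.
Open Scope R_scope.

Definition Cx : Type := (R * R)%type.
Definition Cre (z : Cx) : R := fst z.
Definition Cim (z : Cx) : R := snd z.
Definition RtoC (x : R) : Cx := (x, 0).
Definition C0 : Cx := (0, 0).
Definition C1 : Cx := (1, 0).
Definition Ci : Cx := (0, 1).
Definition Cadd (z w : Cx) : Cx := (fst z + fst w, snd z + snd w).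
Definition Copp (z : Cx) : Cx := (- fst z, - snd z).
Definition Csub (z w : Cx) : Cx := Cadd z (Copp w).
Definition Cmul (z w : Cx) : Cx :=
  (fst z * fst w - snd z * snd w, fst z * snd w + snd z * fst w).
Definition Cinv (z : Cx) : Cx :=
  (fst z / (fst z ^ 2 + snd z ^ 2), - snd z / (fst z ^ 2 + snd z ^ 2)).
Definition Cdiv (z w : Cx) : Cx := Cmul z (Cinv w).
Definition Cconj (z : Cx) : Cx := (fst z, - snd z).
Definition Cabs (z : Cx) : R := sqrt (fst z ^ 2 + snd z ^ 2).
Fixpoint Cpow (z : Cx) (k : nat) : Cx :=
  match k with O => C1 | S k' => Cmul z (Cpow z k') end.

Fixpoint csum (f : nat -> Cx) (n : nat) : Cx :=
  match n with O => C0 | S k => Cadd (csum f k) (f k) end.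

Definition norm2 (w1 w2 : Cx) : R :=
  sqrt (Cabs w1 ^ 2 + Cabs w2 ^ 2).

(* A polynomial with z1-degree <= m and z2-degree <= n is given by its
   coefficient array a : nat -> nat -> Cx (entries a i j with i <= m, j <= n
   are used). *)
Definition peval (m n : nat) (a : nat -> nat -> Cx) (z1 z2 : Cx) : Cx :=
  csum (fun i => csum (fun j => Cmul (a i j) (Cmul (Cpow z1 i) (Cpow z2 j))) (S n)) (S m).

Definition has_bidegree (m n : nat) (a : nat -> nat -> Cx) : Prop :=
  (exists j, (j <= n)%nat /\ a m j <> C0) /\
  (exists i, (i <= m)%nat /\ a i n <> C0).

(* coefficients of the reflection ptilde(z) = z1^m z2^n conj(p(1/conj z1, 1/conj z2)) *)
Definition refl_coef (m n : nat) (a : nat -> nat -> Cx) : nat -> nat -> Cx :=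
  fun i j => Cconj (a (m - i)%nat (n - j)%nat).

Definition ptilde (m n : nat) (a : nat -> nat -> Cx) (z1 z2 : Cx) : Cx :=
  peval m n (refl_coef m n a) z1 z2.

Definition IsPoly (f : Cx -> Cx -> Cx) : Prop :=
  exists d1 d2 (c : nat -> nat -> Cx), forall z1 z2, f z1 z2 = peval d1 d2 c z1 z2.

Definition poly_divides (q f : Cx -> Cx -> Cx) : Prop :=
  exists r, IsPoly r /\ forall z1 z2, f z1 z2 = Cmul (q z1 z2) (r z1 z2).

Definition nonconstant (q : Cx -> Cx -> Cx) : Prop :=
  exists z1 z2 w1 w2, q z1 z2 <> q w1 w2.

Definition atoral (m n : nat) (a : nat -> nat -> Cx) : Prop :=
  forall q, IsPoly q -> nonconstant q ->
    poly_divides q (peval m n a) -> poly_divides q (ptilde m n a) -> False.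

Definition no_zeros_in_bidisk (m n : nat) (a : nat -> nat -> Cx) : Prop :=
  forall z1 z2, Cabs z1 < 1 -> Cabs z2 < 1 -> peval m n a z1 z2 <> C0.

Definition phi (m n : nat) (a : nat -> nat -> Cx) (z1 z2 : Cx) : Cx :=
  Cdiv (ptilde m n a z1 z2) (peval m n a z1 z2).

Definition is_singularity (m n : nat) (a : nat -> nat -> Cx) (t1 t2 : Cx) : Prop :=
  Cabs t1 = 1 /\ Cabs t2 = 1 /\ peval m n a t1 t2 = C0.

Definition sing_z2_coord m n a (t2 : Cx) : Prop := exists t1, is_singularity m n a t1 t2.
Definition sing_z1_coord m n a (t1 : Cx) : Prop := exists t2, is_singularity m n a t1 t2.

Definition eps1 (m n : nat) (a : nat -> nat -> Cx) (zeta2 : Cx) (e : R) : Prop :=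
  (sing_z2_coord m n a zeta2 /\ e = 0) \/
  (~ sing_z2_coord m n a zeta2 /\
   (exists z1, ptilde m n a z1 zeta2 = C0 /\ e = 1 - Cabs z1) /\
   (forall z1, ptilde m n a z1 zeta2 = C0 -> e <= 1 - Cabs z1)).

Definition eps2 (m n : nat) (a : nat -> nat -> Cx) (zeta1 : Cx) (e : R) : Prop :=
  (sing_z1_coord m n a zeta1 /\ e = 0) \/
  (~ sing_z1_coord m n a zeta1 /\
   (exists z2, ptilde m n a zeta1 z2 = C0 /\ e = 1 - Cabs z2) /\
   (forall z2, ptilde m n a zeta1 z2 = C0 -> e <= 1 - Cabs z2)).

Definition local_exponent (eps : Cx -> R -> Prop) (tau : Cx) (K : R) : Prop :=
  0 < K /\
  exists c Cc delta, 0 < c /\ 0 < Cc /\ 0 < delta /\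
    forall zeta, Cabs zeta = 1 -> 0 < Cabs (Csub tau zeta) < delta ->
      exists e, eps zeta e /\
        c * Rpower (Cabs (Csub tau zeta)) K <= e <= Cc * Rpower (Cabs (Csub tau zeta)) K.

Definition is_contact_order1 (m n : nat) (a : nat -> nat -> Cx) (K1 : R) : Prop :=
  (exists t2, sing_z2_coord m n a t2 /\ local_exponent (eps1 m n a) t2 K1) /\
  (forall t2 K, sing_z2_coord m n a t2 -> local_exponent (eps1 m n a) t2 K -> K <= K1).

Definition is_contact_order2 (m n : nat) (a : nat -> nat -> Cx) (K2 : R) : Prop :=
  (exists t1, sing_z1_coord m n a t1 /\ local_exponent (eps2 m n a) t1 K2) /\
  (forall t1 K, sing_z1_coord m n a t1 -> local_exponent (eps2 m n a) t1 K -> K <= K2).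

Definition beta_t (w : Cx) : Cx :=
  Cdiv (Cadd C1 (Cmul Ci w)) (Csub C1 (Cmul Ci w)).

Definition g_tau (m n : nat) (a : nat -> nat -> Cx) (t1 t2 : Cx) (w1 w2 : Cx) : Cx :=
  let f := phi m n a (Cmul t1 (beta_t w1)) (Cmul t2 (beta_t w2)) in
  Cmul Ci (Cdiv (Csub C1 f) (Cadd C1 f)).

Definition taylor_poly (N : nat) (rho : nat -> nat -> R) (w1 w2 : Cx) : Cx :=
  csum (fun j1 => csum (fun j2 =>
     Cmul (RtoC (rho j1 j2)) (Cmul (Cpow w1 j1) (Cpow w2 j2))) (S (N - j1))) (S N).

Definition is_BJ_point (J : nat) (m n : nat) (a : nat -> nat -> Cx) (t1 t2 : Cx) : Prop :=
  (forall eps, 0 < eps -> exists delta, 0 < delta /\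
     forall s, 0 < s < delta ->
       Cabs (g_tau m n a t1 t2 (0, s) (0, s)) < eps) /\
  exists rho : nat -> nat -> R,
    forall c, 0 < c -> exists delta M, 0 < delta /\
      forall w1 w2, 0 < Cim w1 -> 0 < Cim w2 -> norm2 w1 w2 < delta ->
        norm2 (Cinv w1) (Cinv w2) <= c * Rmin (- Cim (Cinv w1)) (- Cim (Cinv w2)) ->
        Cabs (Csub (g_tau m n a t1 t2 w1 w2) (taylor_poly (2 * J - 2) rho w1 w2))
          <= M * norm2 w1 w2 ^ (2 * J - 1).

(* Main.v *)
(* Cayley transforms at tau turn phi into g = N/D with N, D real polynomials such
   that E = D - iN has, for real second coordinate, no zeros in the upper half
   plane.  Write d for the order of vanishing of D at 0.  The B^J condition,
   restricted to real lines through the origin, says that N - P D vanishes to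
   order at least 2J - 1 + d for a polynomial P.

   Blow up: w1 = l x, w2 = x.  Then D = x^d Dh(l, x), and D has a zero at bounded l
   for small x > 0, unless the lowest homogeneous part of D is a multiple of w2^d;
   in that case exchange the variables.  For fixed x the function N/D is a
   Pick function of l.  Summing residues of N / (D W), where W is a fixed
   positive polynomial of large degree with non-real roots, bounds each residue of
   N/D by O(x^(2J-1)), because P contributes nothing and
   (N - P D)/D = O(x^(2J-1)) at the roots of W.  A small residue forces a zero of E
   at distance O(x^(2J-1)) from the real line, i.e. epsilon = O(x^(2J)).

   It remains to see that epsilon is comparable to a power of |zeta - tau2|.  If
   z_1, ..., z_m are the zeros of ptilde(., zeta), then 1/epsilon is
   comparable to the sum over k, l of 1 / (1 - z_k conj(z_l)), since all terms have
   positive real part.  This sum is a rational function of zeta, the logarithmic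
   derivative at t = 1 of the resultant of ptilde(z, zeta) and p(t z, zeta). *)
Require Import Defs.
From Stdlib Require Import Reals.
From mathcomp Require all_boot all_order all_algebra complex Rstruct ring lra.
Open Scope R_scope.

Module ContactOrder.
Import all_boot all_order all_algebra complex Rstruct ring lra.
Set Implicit Arguments. Unset Strict Implicit. Unset Printing Implicit Defensive.
Import Order.TTheory GRing.Theory Num.Theory.
Local Open Scope ring_scope.
Local Open Scope complex_scope.
Local Notation Re := complex.Re.
Local Notation Im := complex.Im.
Local Notation "z ^*" := (conjc z) : ring_scope.
Local Notation "''i'" := (Complex 0 1) : ring_scope.
Local Notation slice z := (map_poly (horner_eval z)).

(** * Complex modulus and estimates for polynomials *)

Section ComplexAbs.
Variable R : rcfType.
Local Notation C := R[i].
Implicit Types z w : C.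

Definition cabs z : R := Num.sqrt (Re z ^+ 2 + Im z ^+ 2).

Lemma cabs_norm z : (cabs z)%:C = `|z|.
Proof. by rewrite normc_def. Qed.
Lemma cabs_ge0 z : 0 <= cabs z.
Proof. exact: sqrtr_ge0. Qed.
Lemma cabsM z w : cabs (z * w) = cabs z * cabs w.
Proof. by apply: complexI; rewrite rmorphM /= !cabs_norm normrM. Qed.
Lemma cabs1 : cabs 1 = 1.
Proof. by apply: complexI; rewrite cabs_norm normr1. Qed.
Lemma cabs0 : cabs 0 = 0.
Proof. by apply: complexI; rewrite cabs_norm normr0. Qed.
Lemma cabsN z : cabs (- z) = cabs z.
Proof. by apply: complexI; rewrite !cabs_norm normrN. Qed.
Lemma cabsB z w : cabs (z - w) = cabs (w - z).
Proof. by rewrite -cabsN opprB. Qed.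
Lemma cabsV z : cabs z^-1 = (cabs z)^-1.
Proof. by apply: complexI; rewrite cabs_norm normfV -cabs_norm -fmorphV. Qed.
Lemma cabsX z n : cabs (z ^+ n) = cabs z ^+ n.
Proof. by apply: complexI; rewrite rmorphXn /= !cabs_norm normrX. Qed.
Lemma cabsD z w : cabs (z + w) <= cabs z + cabs w.
Proof. by rewrite -lecR rmorphD /= !cabs_norm ler_normD. Qed.
Lemma cabs_eq0 z : (cabs z == 0) = (z == 0).
Proof. by rewrite -(inj_eq (@complexI R)) cabs_norm normr_eq0. Qed.
Lemma cabs_gt0 z : (0 < cabs z) = (z != 0).
Proof. by rewrite lt_def cabs_ge0 andbT cabs_eq0. Qed.
Lemma cabsJ z : cabs z^* = cabs z.
Proof. by apply: complexI; rewrite !cabs_norm normcJ. Qed.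
Lemma cabs_real (x : R) : cabs x%:C = `|x|.
Proof. by rewrite /cabs /= expr0n /= addr0 sqrtr_sqr. Qed.
Lemma cabs_i : cabs 'i = 1.
Proof. by rewrite /cabs /= expr0n /= add0r expr1n sqrtr1. Qed.
Lemma cabs_sum (I : Type) (r : seq I) (P : pred I) (F : I -> C) :
  cabs (\sum_(i <- r | P i) F i) <= \sum_(i <- r | P i) cabs (F i).
Proof.
elim/big_rec2: _ => [|i y x _ le_xy]; first by rewrite cabs0.
by apply: le_trans (cabsD _ _) _; rewrite lerD2l.
Qed.
Lemma cabs_prod (I : Type) (r : seq I) (P : pred I) (F : I -> C) :
  cabs (\prod_(i <- r | P i) F i) = \prod_(i <- r | P i) cabs (F i).
Proof. by elim/big_rec2: _ => [|i y x _ <-]; rewrite ?cabs1 ?cabsM. Qed.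
Lemma cabs_sqr z : cabs z ^+ 2 = Re z ^+ 2 + Im z ^+ 2.
Proof. by rewrite sqr_sqrtr ?addr_ge0 ?sqr_ge0. Qed.
Lemma mulcJ_cabs z : z * z^* = (cabs z ^+ 2)%:C.
Proof. by rewrite rmorphXn /= cabs_norm sqr_normc. Qed.
Lemma cabs_geRe z : `|Re z| <= cabs z.
Proof. by rewrite -sqrtr_sqr ler_wsqrtr // lerDl sqr_ge0. Qed.
Lemma cabs_geIm z : `|Im z| <= cabs z.
Proof. by rewrite -sqrtr_sqr ler_wsqrtr // lerDr sqr_ge0. Qed.
Lemma le_cabsB z w : cabs z - cabs w <= cabs (z - w).
Proof. by rewrite lerBlDr -{1}(subrK w z) cabsD. Qed.

End ComplexAbs.

Section PolyEstimates.
Variable R : rcfType.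
Local Notation C := R[i].
Implicit Types (f : {poly C}) (z w : C).

Lemma complex_poly_normal f :
  {r : seq C | f = lead_coef f *: \prod_(z <- r) ('X - z%:P)}.
Proof. exact: closed_field_poly_normal. Qed.

Lemma root_prod f (r : seq C) z : f != 0 ->
  f = lead_coef f *: \prod_(w <- r) ('X - w%:P) -> root f z = (z \in r).
Proof. by move=> f0 ->; rewrite rootZ ?lead_coef_eq0 // root_prod_XsubC. Qed.

Lemma poly_eq0_inj_roots (F : idomainType) (f : {poly F}) (g : nat -> F) :
  injective g -> (forall k, f.[g k] = 0) -> f = 0.
Proof.
move=> injg fg0; apply/eqP; apply: contraT => f0.
have /(max_poly_roots f0): all (root f) (map g (iota 0 (size f))).
  by apply/allP => _ /mapP[k _ ->]; rewrite /root fg0.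
by rewrite (map_inj_uniq injg) iota_uniq size_map size_iota ltnn => /(_ isT).
Qed.

(* If no root of [f] lies within [rho] of [z0], each factor [z1 - r] is at most
   [1 + |z1 - z0| / rho] times [z0 - r]; this replaces Hurwitz' theorem. *)
Lemma cabs_horner_far_roots f z0 z1 (rho : R) M : 0 < rho ->
  (size f <= M.+1)%N -> (forall z, root f z -> rho <= cabs (z - z0)) ->
  cabs f.[z1] <= cabs f.[z0] * (1 + cabs (z1 - z0) / rho) ^+ M.
Proof.
move=> rho0 szf far; have [->|f0] := eqVneq f 0.
  by rewrite !horner0 cabs0 mul0r.
have [r fE] := complex_poly_normal f.
set q := 1 + _ / rho.
have q1 : 1 <= q by rewrite lerDl divr_ge0 ?cabs_ge0 // ltW.
have szr : (size r <= M)%N.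
  have := szf; rewrite {1}fE size_scale ?lead_coef_eq0 // size_prod_XsubC.
  by rewrite ltnS.
have farr z : z \in r -> rho <= cabs (z - z0).
  by move=> zr; apply: far; rewrite (root_prod _ f0 fE).
apply: (@le_trans _ _ (cabs f.[z0] * q ^+ size r)); last first.
  by rewrite ler_wpM2l ?cabs_ge0 // ler_weXn2l.
rewrite fE !hornerZ !cabsM -mulrA ler_wpM2l ?cabs_ge0 //.
rewrite !horner_prod !cabs_prod.
elim: r farr {fE szr} => [|a r IHr] farr; first by rewrite !big_nil mulr1.
rewrite !big_cons /= exprS mulrACA ler_pM ?cabs_ge0 //.
- by apply: prodr_ge0 => i _; apply: cabs_ge0.
- rewrite !hornerE /q mulrDr mulr1.
  have -> : z1 - a = (z0 - a) + (z1 - z0) by ring.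
  apply: le_trans (cabsD _ _) _; rewrite lerD2l mulrC -mulrA ler_peMr ?cabs_ge0 //.
  by rewrite mulrC ler_pdivlMr // mul1r cabsB farr ?mem_head.
- by apply: IHr => z zr; apply: farr; rewrite inE zr orbT.
Qed.

Lemma poly_locally_bounded f z0 : exists2 M : R, 0 < M &
  forall z, cabs (z - z0) <= 1 -> cabs f.[z] <= M.
Proof.
exists (1 + \sum_(i < size f) cabs f`_i * (1 + cabs z0) ^+ i).
  apply: ltr_pwDl => //; apply: sumr_ge0 => i _.
  by rewrite mulr_ge0 ?cabs_ge0 ?exprn_ge0 ?addr_ge0 ?cabs_ge0.
move=> z zz0; rewrite horner_coef; apply: le_trans (cabs_sum _ _ _) _.
apply: le_trans (_ : _ <= \sum_(i < size f) cabs f`_i * (1 + cabs z0) ^+ i) _.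
  apply: ler_sum => i _; rewrite cabsM cabsX ler_wpM2l ?cabs_ge0 //.
  rewrite lerXn2r ?nnegrE ?cabs_ge0 ?addr_ge0 ?cabs_ge0 //.
  by rewrite -[z](subrK z0) (le_trans (cabsD _ _)) // lerD2r.
by rewrite lerDr.
Qed.

Lemma poly_locally_lipschitz f z0 : exists2 M : R, 0 < M &
  forall z, cabs (z - z0) <= 1 -> cabs (f.[z] - f.[z0]) <= M * cabs (z - z0).
Proof.
have /factor_theorem[q qE] : root (f - f.[z0]%:P) z0 by rewrite /root !hornerE subrr.
have [M M0 Mq] := poly_locally_bounded q z0; exists M => // z zz0.
have -> : f.[z] - f.[z0] = q.[z] * (z - z0).
  by have := congr1 (fun g => g.[z]) qE; rewrite !hornerE.
by rewrite cabsM ler_wpM2r ?cabs_ge0 // Mq.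
Qed.

Lemma poly_locally_nonzero f z0 : f.[z0] != 0 -> exists2 d : R, 0 < d <= 1 &
  forall z, cabs (z - z0) <= d -> cabs f.[z0] / 2 <= cabs f.[z].
Proof.
move=> fz0; have a0 : 0 < cabs f.[z0] by rewrite cabs_gt0.
have [M M0 Ml] := poly_locally_lipschitz f z0.
set a := cabs f.[z0] in a0 *.
exists (Num.min 1 (a / 2 / M)).
  by rewrite lt_min ltr01 ge_min lexx /= !divr_gt0.
move=> z; rewrite le_min => /andP[z1 z2].
have := Ml z z1; rewrite ler_pdivlMr // in z2.
have := le_cabsB f.[z0] f.[z]; rewrite -(cabsB f.[z]) -/a.
lra.
Qed.

Lemma poly_small_at_root f z0 (e : R) : f.[z0] = 0 -> 0 < e ->
  exists2 d : R, 0 < d <= 1 & forall z, cabs (z - z0) <= d -> cabs f.[z] <= e.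
Proof.
move=> fz0 e0; have [M M0 Ml] := poly_locally_lipschitz f z0.
exists (Num.min 1 (e / M)).
  by rewrite lt_min ltr01 ge_min lexx /= divr_gt0.
move=> z; rewrite le_min => /andP[z1 z2].
have := Ml z z1; rewrite fz0 subr0 ler_pdivlMr // in z2 *.
lra.
Qed.

End PolyEstimates.

(** * Lagrange interpolation and vanishing residue sums *)

Section Lagrange.
Variable F : fieldType.

Lemma deriv_prod_root (s : seq F) (r : F) : uniq s -> r \in s ->
  (\prod_(q <- s) ('X - q%:P))^`().[r] = (\prod_(q <- rem r s) ('X - q%:P)).[r].
Proof.
move=> us rs; rewrite (perm_big _ (perm_to_rem rs)) big_cons /=.
by rewrite derivM derivXsubC mul1r !hornerE subrr mul0r addr0.
Qed.

(** Interpolation at [s] reproduces [f], so the sum is the coefficient of degree [(size s).-1] of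
    [f], which is zero. In other words, the residues of [f / T] sum to zero when the degree of [f]
    is at least two below that of [T]. *)
Lemma lagrange_sum_eq0 (s : seq F) (f : {poly F}) :
  uniq s -> (size f < size s)%N ->
  \sum_(r <- s) f.[r] / (\prod_(q <- s) ('X - q%:P))^`().[r] = 0.
Proof.
move=> us szf; set T := \prod_(q <- s) _.
pose l r := \prod_(q <- rem r s) ('X - q%:P).
pose g := \sum_(r <- s) (f.[r] / T^`().[r]) *: l r.
have szl r : r \in s -> size (l r) = size s.
  by move=> rs; rewrite size_prod_XsubC size_rem // prednK //; case: (s) rs.
have Tr r : r \in s -> T^`().[r] = (l r).[r] by move=> rs; rewrite deriv_prod_root.
have lrr r : r \in s -> (l r).[r] != 0.
  by move=> rs; rewrite -rootE root_prod_XsubC mem_rem_uniq // !inE eqxx.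
have lrq r q : q \in s -> r != q -> (l r).[q] = 0.
  move=> qs rq; apply/eqP; rewrite -rootE root_prod_XsubC mem_rem_uniq // !inE qs andbT.
  by rewrite eq_sym.
have gE q : q \in s -> g.[q] = f.[q].
  move=> qs; rewrite horner_sum (bigD1_seq q) //= hornerZ Tr // divfK ?lrr //.
  by rewrite big1 ?addr0 // => r rq; rewrite hornerZ lrq ?mulr0.
have fg : f = g.
  apply/eqP; rewrite -subr_eq0; apply: contraT => fg0.
  have /(max_poly_roots fg0) : all (root (f - g)) s.
    by apply/allP => q qs; rewrite /root !hornerE gE // subrr.
  rewrite us => /(_ isT); rewrite ltnNge; case/negP.
  rewrite (leq_trans (size_polyD _ _)) // size_polyN geq_max (ltnW szf) /=.
  rewrite /g big_seq; apply: (leq_trans (size_sum _ _ _)).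
  by apply/bigmax_leqP_seq => r _ rs; rewrite (leq_trans (size_scale_leq _ _)) ?szl.
have := congr1 (fun h : {poly F} => h`_(size s).-1) fg.
rewrite /= nth_default; last by rewrite -ltnS (ltn_predK szf).
rewrite coef_sum => /esym gsum; rewrite -[RHS]gsum !big_seq.
apply: eq_bigr => r rs; rewrite coefZ -(szl r rs) -lead_coefE.
by rewrite (eqP (monic_prod_XsubC _ _ _)) mulr1.
Qed.

End Lagrange.

(** * Residues of Hermite-Biehler pairs *)

Lemma nuniq_rem (T : eqType) (s : seq T) : ~~ uniq s ->
  exists2 x, x \in s & x \in rem x s.
Proof.
elim: s => //= a s IHs; rewrite negb_and negbK.
have [as_ _|as_ /= /IHs[x xs xr]] := boolP (a \in s).
  by exists a; rewrite ?mem_head ?eqxx.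
exists x; first by rewrite inE xs orbT.
by case: eqP => // _; rewrite inE xr orbT.
Qed.

Lemma uniq_simple_roots (F : fieldType) (s : seq F) :
  (forall x, x \in s -> (\prod_(q <- s) ('X - q%:P))^`().[x] != 0) -> uniq s.
Proof.
move=> simple; apply: contraT => /nuniq_rem[x xs xr].
move/eqP: (simple x xs); case.
rewrite (perm_big _ (perm_to_rem xs)) big_cons derivM derivXsubC mul1r !hornerE.
rewrite subrr mul0r addr0; apply/eqP; rewrite -rootE.
by rewrite root_prod_XsubC.
Qed.

Lemma horner_deriv_prod_XsubC (F : fieldType) (s : seq F) x : x \notin s ->
  (\prod_(q <- s) ('X - q%:P))^`().[x] =
  (\prod_(q <- s) ('X - q%:P)).[x] * \sum_(q <- s) (x - q)^-1.
Proof.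
elim: s => [|a s IHs]; first by rewrite !big_nil derivC !hornerE ?mulr0.
rewrite inE negb_or => /andP[xa xs]; rewrite !big_cons derivM derivXsubC mul1r !hornerE.
rewrite IHs // mulrDr mulrAC divff ?subr_eq0 // mul1r; ring.
Qed.

Section HermiteBiehler.
Variable R : rcfType.
Local Notation C := R[i].
Variables (E : {poly C}) (h : R).
Hypothesis h_gt0 : 0 < h.
Hypothesis rootsE : forall a, root E a -> Im a <= - h.

(** [D] and [N] have real coefficients, [D - 'i N = 2 E], and [N / D] is the Cayley transform
    ['i (1 - f) / (1 + f)] of [f = Es / E], the same formula as in [g_tau]. *)
Let Es := map_poly conjc E.
Let D := E + Es.
Let N := 'i *: (E - Es).
Hypothesis D_neq0 : D != 0.

Lemma horner_conj (w : C) : Es.[w] = (E.[w^*])^*.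
Proof. by rewrite /Es -[in LHS](conjcK w) horner_map. Qed.

Lemma HB_E_neq0 : E != 0.
Proof.
by apply: contra_neq D_neq0 => E0; rewrite /D /Es E0 map_poly0 addr0.
Qed.

(** Each root lies in the lower half plane, hence is farther from [w] than from its conjugate.
    Strictness needs at least one root, that is, a nonconstant [E]. *)
Lemma HB_cabs_lt (w : C) : (1 < size E)%N -> 0 < Im w -> cabs E.[w^*] < cabs E.[w].
Proof.
have [r Er] := complex_poly_normal E.
have memr a : a \in r -> Im a < 0.
  by rewrite -(root_prod _ HB_E_neq0 Er) => /rootsE ah; apply: le_lt_trans ah _; rewrite oppr_lt0.
move=> szE w0; have l0 : 0 < cabs (lead_coef E) by rewrite cabs_gt0 lead_coef_eq0 HB_E_neq0.
have : (0 < size r)%N.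
  by move: szE; rewrite Er size_scale ?lead_coef_eq0 ?HB_E_neq0 // size_prod_XsubC.
rewrite Er !hornerZ !cabsM ltr_pM2l // !horner_prod !cabs_prod.
have step a : a \in r -> cabs ('X - a%:P).[w^*] < cabs ('X - a%:P).[w].
  move=> /memr a0; rewrite !hornerE -(ltr_pXn2r (ltn0Sn 1)) ?nnegrE ?cabs_ge0 //.
  rewrite !cabs_sqr; case: (a) a0 (w) w0 => [a1 a2] /= a20 [w1 w2] /= w20; nra.
elim: r step {Er memr} => // a r IHr step _; rewrite !big_cons.
have pos : 0 < \prod_(j <- r) cabs ('X - j%:P).[w].
  rewrite big_seq; apply: prodr_gt0 => j jr; apply: le_lt_trans (cabs_ge0 ('X - j%:P).[w^*]) _.
  by apply: step; rewrite inE jr orbT.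
apply: (@le_lt_trans _ _ (cabs ('X - a%:P).[w^*] * \prod_(j <- r) cabs ('X - j%:P).[w])).
  rewrite ler_wpM2l ?cabs_ge0 //; case: (r) IHr step => [|b r'] IHr step.
    by rewrite !big_nil.
  by apply/ltW/IHr => // c cr; apply: step; rewrite inE cr orbT.
by rewrite ltr_pM2r // step ?mem_head.
Qed.

Lemma HB_size_gt1 (p : C) : root D p -> (1 < size E)%N.
Proof.
move=> Dp; rewrite ltnNge; apply/negP => /size1_polyC Ec; move: Dp D_neq0.
by rewrite /D /Es Ec map_polyC /= -rmorphD rootC /= polyC_eq0 => /eqP ->; rewrite eqxx.
Qed.

(** At a root of [D] the values of [E] and [Es] are opposite, so [E] has equal modulus at the point
    and at its conjugate; [HB_cabs_lt] excludes this off the real line. *)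
Lemma HB_root_real (p : C) : root D p -> Im p = 0.
Proof.
move=> Dp; have szE := HB_size_gt1 Dp.
have Dw (w : C) : root D w -> cabs E.[w^*] = cabs E.[w].
  rewrite /root /D hornerD horner_conj addr_eq0 => /eqP ->.
  by rewrite cabsN cabsJ.
have [p0|p0|//] := ltgtP (Im p) 0; last first.
  by have := HB_cabs_lt szE p0; rewrite Dw ?ltxx.
have pc : 0 < Im p^* by case: (p) p0 => a b /= b0; rewrite oppr_gt0.
by have := HB_cabs_lt szE pc; rewrite conjcK Dw ?ltxx.
Qed.

(** [S] is minus the imaginary part of the logarithmic derivative of [E] at [p], a sum over the
    roots [a] of [- Im a / |p - a|^2]. Each term is positive and at most [1 / h], because
    [|p - a| >= - Im a >= h]. The residue of [N / D] at [p] is then [- 1 / S]. *)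
Lemma HB_root_deriv (p : C) : root D p ->
  exists S : R, [/\ 0 < S, S <= (size E)%:R / h, N.[p] != 0 & D^`().[p] = - S%:C * N.[p]].
Proof.
move=> Dp; have [r Er] := complex_poly_normal E.
have rE a : (a \in r) = root E a by rewrite (root_prod _ HB_E_neq0 Er).
have pr : p^* = p by case: (p) (HB_root_real Dp) => a b /= ->; rewrite oppr0.
have szr : size E = (size r).+1.
  by rewrite Er size_scale ?lead_coef_eq0 ?HB_E_neq0 // size_prod_XsubC.
have Ep0 : E.[p] != 0.
  by apply/negP => Ep; have := @rootsE p Ep; rewrite HB_root_real // => hh; have := h_gt0; lra.
have Ep : (E.[p])^* = - E.[p].
  by move/eqP: Dp; rewrite /D hornerD horner_conj pr => /eqP; rewrite addrC addr_eq0 => /eqP.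
pose sg := \sum_(a <- r) (p - a)^-1.
have E'p : E^`().[p] = E.[p] * sg.
  rewrite Er derivZ !hornerZ horner_deriv_prod_XsubC ?mulrA //.
  by rewrite rE /root Ep0.
have Np : N.[p] = 2 * 'i * E.[p].
  by rewrite /N hornerZ hornerD hornerN horner_conj pr Ep; ring.
have D'p : D^`().[p] = (Im sg)%:C * N.[p].
  have -> : D^`().[p] = E^`().[p] + (E^`().[p])^*.
    rewrite /D /Es derivD deriv_map hornerD -{2}pr horner_map //.
  rewrite E'p rmorphM /= Ep Np -[RHS]mulr1 -[in RHS](mulr1 (Im sg)%:C).
  have -> : E.[p] * sg + - E.[p] * sg^* = E.[p] * (sg - sg^*) by ring.
  by rewrite subcJ; ring.
have Imsg : Im sg = \sum_(a <- r) - (- Im a / cabs (p - a) ^+ 2).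
  rewrite /sg; elim: (r) => [|a s IHs]; first by rewrite !big_nil.
  rewrite !big_cons -IHs; set X := \sum_(j <- s) _.
  rewrite -[Im (_ + X)]/(Im _) raddfD /= cabs_sqr.
  congr (_ + _).
  by case: (p) (HB_root_real Dp) (a) => [p1 p2] /= -> [a1 a2] /=; ring.
have term a : a \in r -> 0 < - Im a / cabs (p - a) ^+ 2 <= h^-1.
  rewrite rE => /rootsE ah.
  have pa0 : 0 < cabs (p - a) ^+ 2.
    rewrite exprn_gt0 // cabs_gt0 subr_eq0; apply/eqP => pa.
    by have := HB_root_real Dp; rewrite pa; (have := h_gt0; lra).
  apply/andP; split; first by apply: divr_gt0 => //; (have := h_gt0; lra).
  rewrite ler_pdivrMr // mulrC ler_pdivlMr // cabs_sqr.
  case: (p) (HB_root_real Dp) (a) ah => [p1 p2] /= -> [a1 a2] /= ah.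
  have h0 := h_gt0.
  have q0 : 0 <= (- a2) * (- a2 - h) by apply: mulr_ge0; lra.
  by have := sqr_ge0 (p1 - a1); nra.
have szr0 : (0 < size r)%N by have := HB_size_gt1 Dp; rewrite szr.
exists (\sum_(a <- r) (- Im a / cabs (p - a) ^+ 2)); split.
- rewrite big_seq; case: (r) szr0 term => // b s _ term.
  rewrite -big_seq big_cons; apply: ltr_wpDr; last by case/andP: (term b (mem_head _ _)).
  rewrite big_seq; apply: sumr_ge0 => a as_.
  by have /andP[/ltW] := term a (mem_behead (s := b :: s) as_).
- apply: (@le_trans _ _ (\sum_(a <- r) h^-1)).
    by rewrite !big_seq; apply: ler_sum => a /term/andP[].
  rewrite big_const_seq count_predT iter_addr_0 -[X in X <= _]mulr_natl.
  by rewrite ler_wpM2r ?invr_ge0 ?(ltW h_gt0) // szr ler_nat leqnSn.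
- by rewrite Np !mulf_neq0 // ?pnatr_eq0 // eq_complex /= oner_eq0 andbF.
- rewrite D'p Imsg; congr (_ * _).
  by rewrite sumrN rmorphN.
Qed.

(* Sum of the residues of [N / (D W)]: those at the roots of [D] all have the same
   sign, and [P] drops out of those at the roots [s] of [W]. *)
Lemma HB_residue_bound (s : seq C) (P : {poly C}) (p0 : C) :
  root D p0 -> uniq s -> (forall w, w \in s -> Im w != 0) ->
  (forall x : R, 0 < (\prod_(q <- s) ('X - q%:P)).[x%:C]) ->
  (size E < size s)%N -> (size P < size s)%N ->
  h / (size E)%:R / cabs (\prod_(q <- s) ('X - q%:P)).[p0] <=
  \sum_(w <- s) cabs ((N - P * D).[w] / D.[w] / (\prod_(q <- s) ('X - q%:P))^`().[w]).
Proof.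
move=> Dp0 us ims; set W := \prod_(q <- s) _ => Wpos szE szP.
have [u Du] := complex_poly_normal D.
have uE p : (p \in u) = root D p by rewrite (root_prod _ D_neq0 Du).
set U := \prod_(z <- u) _ in Du.
set l : C := lead_coef D in Du; have l0 : l != 0 by rewrite lead_coef_eq0.
(* The derivative of [D] is nonzero at every root of [D] by [HB_root_deriv], so the poles of [N / D]
   are simple. *)
have uu : uniq u.
  apply: uniq_simple_roots => p; rewrite uE => /HB_root_deriv[S [S0 _ N0 D'p]].
  apply: contraNneq N0 => U'p; move: D'p; rewrite Du derivZ hornerZ U'p mulr0.
  move/esym/eqP; rewrite mulf_eq0 oppr_eq0 => /orP[|//].
  by rewrite eq_complex /= eqxx andbT gt_eqF.
have sD w : w \in s -> D.[w] != 0.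
  by move=> ws; apply/negP => /HB_root_real w0; have := ims w ws; rewrite w0 eqxx.
have uus : uniq (u ++ s).
  rewrite cat_uniq uu us andbT; apply/hasPn => w ws; rewrite uE.
  by rewrite /root sD.
have szN : (size N < size (u ++ s))%N.
  rewrite size_cat; apply: leq_ltn_trans (ltn_addl _ szE).
  rewrite (leq_trans (size_scale_leq _ _)) // (leq_trans (size_polyD _ _)) //.
  by rewrite size_polyN size_map_poly_id0 ?maxnn // conjc_eq0 lead_coef_eq0 HB_E_neq0.
(* [N] is interpolated at the roots of [D W], but [P] at the roots of [W] only: [P D / (D W)] has no
   pole at the roots of [D]. *)
have := lagrange_sum_eq0 uus szN; have := lagrange_sum_eq0 us szP.
rewrite !big_cat /= -/U -/W => sumP.
pose c p := - (N.[p] / D^`().[p]).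
have cP p : p \in u -> exists S : R, [/\ 0 < S, S <= (size E)%:R / h & c p = (S^-1)%:C].
  rewrite uE => /HB_root_deriv[S [S0 Sh N0 D'p]]; exists S; split=> //.
  have S0' : S%:C != 0 by rewrite eq_complex /= eqxx andbT gt_eqF.
  by rewrite /c D'p fmorphV; field; rewrite S0' N0.
have UW p : p \in u -> N.[p] / (U * W)^`().[p] = - l * (c p / W.[p]).
  move=> pu; have D'p : D^`().[p] = l * U^`().[p] by rewrite Du derivZ hornerZ.
  have Up : U.[p] = 0.
    by move: pu; rewrite uE Du rootZ // => /rootP.
  have [S [S0 _ cS]] := cP p pu.
  have : c p != 0 by rewrite cS eq_complex /= eqxx andbT gt_eqF // invr_gt0.
  rewrite /c oppr_eq0 mulf_eq0 negb_or invr_eq0 => /andP[N0].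
  rewrite D'p derivM hornerD !hornerM Up mul0r addr0 mulf_eq0 negb_or => /andP[_ U'0].
  have p_re : Im p = 0 by apply: HB_root_real; rewrite -uE.
  have W0 : W.[p] != 0.
    have -> : p = (Re p)%:C by case: (p) p_re => a b /= ->.
    by rewrite gt_eqF.
  by field; rewrite l0 U'0 W0.
have UWs w : w \in s -> N.[w] / (U * W)^`().[w] = l * (N.[w] / D.[w] / W^`().[w]).
  move=> ws; have W0 : W.[w] = 0 by apply/eqP; rewrite -rootE root_prod_XsubC.
  rewrite derivM hornerD !hornerM W0 mulr0 add0r.
  have -> : D.[w] = l * U.[w] by rewrite Du hornerZ.
  rewrite !invfM.
  by move: (U.[w])^-1 (W^`().[w])^-1 => x y; field.
rewrite big_seq (eq_bigr _ UW) -big_seq [X in _ + X]big_seq (eq_bigr _ UWs) -big_seq.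
rewrite -!mulr_sumr mulNr addrC => /eqP; rewrite subr_eq0 => /eqP /(mulfI l0) sums.
pose Z := \sum_(w <- s) ((N - P * D).[w] / D.[w] / W^`().[w]).
have ZE : \sum_(p <- u) (c p / W.[p]) = Z.
  rewrite -sums /Z -[LHS]subr0 -[X in _ - X]sumP -sumrB big_seq [RHS]big_seq.
  apply: eq_bigr => w ws.
  have -> : (N - P * D).[w] = N.[w] - P.[w] * D.[w] by rewrite hornerD hornerN hornerM.
  by rewrite [in RHS]mulrBl mulfK ?sD // mulrBl.
have tpos p : p \in u -> 0 <= c p / W.[p].
  move=> pu; have [S [S0 _ ->]] := cP p pu; rewrite divr_ge0 ?ler0c ?invr_ge0 ?ltW //.
  have p_re : Im p = 0 by apply: HB_root_real; rewrite -uE.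
  by have -> : p = (Re p)%:C by case: (p) p_re => a b /= ->.
have p0u : p0 \in u by rewrite uE.
have tZ : c p0 / W.[p0] <= Z.
  rewrite -ZE (bigD1_seq p0) //= lerDl big_seq_cond sumr_ge0 // => p /andP[pu _].
  exact: tpos.
have [S [S0 Sh cS]] := cP p0 p0u.
apply: le_trans (_ : cabs (c p0 / W.[p0]) <= _).
  rewrite cabsM cabsV ler_wpM2r ?invr_ge0 ?cabs_ge0 // cS cabs_real.
  rewrite ger0_norm ?invr_ge0 ?(ltW S0) // -[X in X <= _]invf_div lef_pV2 ?posrE //.
  exact: lt_le_trans Sh.
apply: le_trans (cabs_sum _ _ _); rewrite -/Z -lecR !cabs_norm.
by rewrite ger0_norm ?tpos // ger0_norm // (le_trans _ tZ) // tpos.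
Qed.

End HermiteBiehler.

(** * The bound in a blow-up chart *)

Section Misc.
Variable R : rcfType.
Local Notation C := R[i].

Lemma exists_near_root (f : {poly C}) z0 z1 (rho : R) M : 0 < rho ->
  (size f <= M.+1)%N ->
  cabs f.[z0] * (1 + cabs (z1 - z0) / rho) ^+ M < cabs f.[z1] ->
  exists2 z, root f z & cabs (z - z0) < rho.
Proof.
move=> rho0 szf lt01; have f0 : f != 0.
  by apply: contraTneq lt01 => ->; rewrite !horner0 cabs0 mul0r ltxx.
have [r fE] := complex_poly_normal f.
have rE z := root_prod z f0 fE.
have [/hasP[z zr zz]|/hasPn far] := boolP (has (fun z => cabs (z - z0) < rho) r).
  by exists z; rewrite ?rE.
move: lt01; rewrite ltNge cabs_horner_far_roots // => z; rewrite rE => /far.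
by rewrite -leNgt.
Qed.

Lemma natr_inj : injective (fun k : nat => k%:R : C).
Proof. by move=> k l /eqP; rewrite eqr_nat => /eqP. Qed.

Lemma poly_nonroot (f : {poly C}) : f != 0 -> exists z, f.[z] != 0.
Proof.
move=> f0; have [al|/allPn[z _ z0]] :=
  boolP (all (root f) [seq k%:R | k <- iota 0 (size f)]); last by exists z.
have := max_poly_roots f0 al.
by rewrite (map_inj_uniq natr_inj) iota_uniq size_map size_iota ltnn => /(_ isT).
Qed.

Lemma poly_factor_X (A : idomainType) (f : {poly A}) : f != 0 ->
  exists d, exists2 g : {poly A}, f = 'X^d * g & g`_0 != 0.
Proof.
move=> f0; have [d [g rg fE]] := multiplicity_XsubC f 0.
exists d, g; first by rewrite {1}fE subr0 mulrC.
by move: rg; rewrite f0 /= /root horner_coef0.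
Qed.

(** Letting [s] tend to 0 kills the constant coefficient; dividing by ['X] lowers [K] by one. *)
Lemma coef_small_eq0 (f : {poly C}) (K : nat) (M e : R) : 0 < e ->
  (forall s : R, 0 < s < e -> cabs f.['i * s%:C] <= M * s ^+ K) ->
  forall j, (j < K)%N -> f`_j = 0.
Proof.
elim: K f => // K IHK f e0 small.
have M0 : 0 <= M.
  have h2 : 0 < e / 2 < e by lra.
  have := le_trans (cabs_ge0 _) (small _ h2).
  by rewrite pmulr_lge0 // exprn_gt0 //; lra.
have f0 : f`_0 = 0.
  apply/eqP; rewrite -cabs_eq0 eq_le cabs_ge0 andbT leNgt; apply/negP => c0.
  have [L L0 Ll] := poly_locally_lipschitz f 0.
  set c := cabs f`_0 in c0.
  (* The choice gives [c <= (M + L) s <= c / 2]: [M s] bounds the value at ['i s], and [L s] its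
     difference from the constant coefficient. *)
  pose s := Num.min (Num.min 1 (e / 2)) (c / 2 / (M + L)).
  have ML : 0 < M + L by lra.
  have s0 : 0 < s by rewrite !lt_min ltr01 !divr_gt0.
  have [s1 se] : s <= 1 /\ s <= e / 2 by split; rewrite /s !ge_min lexx ?orbT.
  have sc : s * (M + L) <= c / 2 by rewrite -ler_pdivlMr // /s ge_min lexx orbT.
  have sX : s ^+ K.+1 <= s by rewrite -[leRHS]expr1 ler_wiXn2l // ltW.
  have /small fs : 0 < s < e by lra.
  have cs : cabs ('i * s%:C) = s by rewrite cabsM cabs_i mul1r cabs_real gtr0_norm.
  have := Ll ('i * s%:C); rewrite subr0 cs => /(_ s1).
  rewrite horner_coef0 cabsB => fL.
  have := le_cabsB f`_0 f.['i * s%:C]; rewrite -/c.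
  have : M * s ^+ K.+1 <= M * s by rewrite ler_wpM2l.
  nra.
have [g gE] : exists g, f = g * 'X.
  exists (drop_poly 1 f); rewrite -{1}(poly_take_drop 1 f) expr1.
  rewrite [X in X + _](_ : _ = 0) ?add0r //.
  by apply/polyP => i; rewrite coef_take_poly coef0 ltnS leqn0; case: eqP => // ->.
have gK : forall j, (j < K)%N -> g`_j = 0.
  apply: IHK => // s se; have s0 : 0 < s by case/andP: se.
  have := small s se; rewrite gE hornerMX cabsM.
  rewrite cabsM cabs_i mul1r cabs_real gtr0_norm // exprSr mulrA ler_pM2r //.
by case=> [//|j] jK; rewrite gE coefMX /= gK.
Qed.

End Misc.

(** * Bivariate polynomials in the blow-up chart *)

Section Charts.
Variable R : rcfType.
Local Notation C := R[i].
Implicit Types (F G : {poly {poly C}}) (l x : C).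

(* The outer variable of [F] is set to [x], the inner one to [l]. *)
Definition ev l x F : C := F.[x%:P].[l].

Lemma ev_is_map l x F : ev l x F = (map_poly (horner_eval l) F).[x].
Proof.
by rewrite /ev -[F.[_].[l]]/(horner_eval l F.[x%:P]) -horner_map /= /horner_eval hornerC.
Qed.

Lemma evM l x F G : ev l x (F * G) = ev l x F * ev l x G.
Proof. by rewrite /ev !hornerM. Qed.
Lemma evD l x F G : ev l x (F + G) = ev l x F + ev l x G.
Proof. by rewrite /ev !hornerD. Qed.
Lemma evN l x F : ev l x (- F) = - ev l x F.
Proof. by rewrite /ev !hornerN. Qed.
Lemma evXn l x F n : ev l x (F ^+ n) = ev l x F ^+ n.
Proof. by rewrite /ev !horner_exp. Qed.
Lemma evX l x : ev l x 'X = x.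
Proof. by rewrite /ev hornerX hornerC. Qed.
Lemma evC l x (f : {poly C}) : ev l x f%:P = f.[l].
Proof. by rewrite /ev hornerC. Qed.
Lemma ev_sum l x (I : Type) (r : seq I) (P : pred I) (G : I -> {poly {poly C}}) :
  ev l x (\sum_(i <- r | P i) G i) = \sum_(i <- r | P i) ev l x (G i).
Proof. by rewrite /ev !horner_sum. Qed.

Lemma ev0 l F : ev l 0 F = (F`_0).[l].
Proof. by rewrite /ev polyC0 horner_coef0. Qed.

Lemma size_horner_polyC x F : (size F.[x%:P] <= \max_(i < size F) size (F`_i)%R)%N.
Proof.
rewrite horner_coef; apply: leq_trans (size_sum _ _ _) _.
apply/bigmax_leqP => i _; rewrite -polyC_exp mulrC mul_polyC.
by apply: leq_trans (size_scale_leq _ _) _; apply: (@leq_bigmax _ (fun i : 'I_(size F) => size (F`_i)%R)).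
Qed.

(** For real [x] the slice of [conj2 F] at [x] is the polynomial [Es] attached to the slice [E] of
    [F]; this is where the results on Hermite-Biehler pairs enter. *)
Definition conj2 F := map_poly (map_poly conjc) F.

Lemma conj2_horner F (x : R) : (conj2 F).[x%:C%:P] = map_poly conjc F.[x%:C%:P].
Proof.
by rewrite /conj2 -[in LHS](_ : map_poly conjc x%:C%:P = x%:C%:P) ?horner_map // map_polyC /= oppr0.
Qed.

Lemma ev_conj2 l x F : ev l x (conj2 F) = (ev l^* x^* F)^*.
Proof.
rewrite /ev /conj2 -[in LHS](_ : map_poly conjc x^*%:P = x%:P); last first.
  by rewrite map_polyC /= conjcK.
by rewrite horner_map /= -[in LHS](conjcK l) horner_map.
Qed.

(* The points [(l s i, s i)] with [l > 0] are non-tangential, so a bound there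
   controls all low order coefficients in the chart [w1 = l x], [w2 = x]. *)
Lemma order_transfer (H D Dh : {poly {poly C}}) (k d : nat) :
  D = 'X^d * Dh -> Dh`_0 != 0 ->
  (forall l : R, 0 < l -> exists e M : R, 0 < e /\ forall s : R, 0 < s < e ->
    ev l%:C ('i * s%:C) D != 0 ->
    cabs (ev l%:C ('i * s%:C) H) <= M * s ^+ k * cabs (ev l%:C ('i * s%:C) D)) ->
  exists Rh, H = 'X^(k + d) * Rh.
Proof.
move=> DE Dh0 small.
suff H0 j : (j < k + d)%N -> H`_j = 0.
  exists (drop_poly (k + d) H); rewrite -{1}(poly_take_drop (k + d) H) mulrC.
  rewrite [X in X + _](_ : _ = 0) ?add0r //.
  by apply/polyP => i; rewrite coef_take_poly coef0; case: ifP => // /H0.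
move=> jkd; apply/eqP.
suff /eqP : H`_j * Dh`_0 = 0 by rewrite mulf_eq0 (negbTE Dh0) orbF.
apply: (@poly_eq0_inj_roots _ _ (fun n : nat => n.+1%:R)).
  by move=> a b /eqP; rewrite eqr_nat eqSS => /eqP.
move=> n; set l : R := n.+1%:R.
have lE : n.+1%:R = l%:C by rewrite rmorph_nat.
rewrite lE hornerM; have [->|dl0] := eqVneq (Dh`_0).[l%:C] 0; first by rewrite mulr0.
have l0 : 0 < l by rewrite ltr0n.
have [e [M [e0 Ms]]] := small l l0.
set f := map_poly (horner_eval l%:C) H.
have -> : (H`_j).[l%:C] = f`_j by rewrite coef_map.
set dh := map_poly (horner_eval l%:C) Dh.
have dh0 : dh.[0] != 0 by rewrite horner_coef0 coef_map.
have [e1 /andP[e10 e11] dhlow] := poly_locally_nonzero dh0.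
have [B B0 dhB] := poly_locally_bounded dh 0.
rewrite [f`_j](@coef_small_eq0 _ f (k + d) (`|M| * B) (Num.min e e1)) ?mul0r //.
  by rewrite lt_min e0.
move=> s /andP[s0]; rewrite lt_min => /andP[se se1].
have cs : cabs ('i * s%:C) = s by rewrite cabsM cabs_i mul1r cabs_real gtr0_norm.
have evD' : ev l%:C ('i * s%:C) D = ('i * s%:C) ^+ d * dh.['i * s%:C].
  by rewrite DE evM evXn evX ev_is_map.
have dhs : 0 < cabs dh.['i * s%:C].
  apply: lt_le_trans (dhlow _ _); last by rewrite subr0 cs ltW.
  by rewrite divr_gt0 // cabs_gt0.
have Ds : ev l%:C ('i * s%:C) D != 0.
  by rewrite evD' mulf_neq0 // -?cabs_gt0 // cabsX cs exprn_gt0.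
have ss : 0 < s < e by rewrite s0.
have := Ms s ss Ds; rewrite -ev_is_map => /le_trans; apply.
rewrite evD' cabsM cabsX cs exprD; set c := cabs _.
have skd : 0 <= s ^+ k * s ^+ d by rewrite mulr_ge0 ?exprn_ge0 // ltW.
rewrite [leLHS](_ : _ = M * (s ^+ k * s ^+ d * c)); last by ring.
rewrite [leRHS](_ : _ = `|M| * (s ^+ k * s ^+ d * B)); last by ring.
apply: le_trans (ler_norm _) _; rewrite normrM ler_wpM2l ?normr_ge0 //.
have -> : `|s ^+ k * s ^+ d * c| = s ^+ k * s ^+ d * c.
  by rewrite ger0_norm // (mulr_ge0 skd) ?cabs_ge0.
rewrite (ler_wpM2l skd) // dhB // subr0 cs ltW //.
exact: lt_le_trans se1 e11.
Qed.

(** The simple roots of the product of [x^2 + k^2] for [k] from 1 to [L], which is positive on the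
    real line. They are at distance at least 1 from it and do not depend on the chart variable. *)
Definition nodes L : seq C :=
  [seq 'i * k.+1%:R%:C | k <- iota 0 L] ++ [seq - ('i * k.+1%:R%:C) | k <- iota 0 L].

Lemma Im_inode (k : nat) : Im ('i * (k.+1%:R : R)%:C) = k.+1%:R.
Proof. by rewrite /= mul0r mul1r add0r. Qed.

Lemma size_nodes L : size (nodes L) = (L + L)%N.
Proof. by rewrite size_cat !size_map size_iota. Qed.

Lemma nodes_Im L w : w \in nodes L -> 1 <= `|Im w|.
Proof.
rewrite mem_cat => /orP[] /mapP[k _ ->]; rewrite ?raddfN /= ?normrN mul0r mul1r add0r;
  by rewrite normr_nat ler1n.
Qed.

Lemma uniq_nodes L : uniq (nodes L).
Proof.
have injk : injective (fun k : nat => 'i * (k.+1%:R : R)%:C : C).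
  move=> k l /(congr1 (@complex.Im R)); rewrite !Im_inode => /eqP.
  by rewrite eqr_nat eqSS => /eqP.
rewrite cat_uniq !map_inj_uniq ?iota_uniq //; last by move=> k l /oppr_inj/injk.
rewrite andbT /=; apply/hasPn => _ /mapP[k _ ->]; apply/mapP => -[l _].
move/(congr1 (@complex.Im R)); rewrite raddfN /= !mul0r !mul1r !add0r => /eqP.
by rewrite lt_eqF // (lt_trans (_ : _ < 0)) ?oppr_lt0 ?ltr0n.
Qed.

Lemma nodes_prod_gt0 L (x : R) : 0 < (\prod_(q <- nodes L) ('X - q%:P)).[x%:C].
Proof.
rewrite /nodes big_cat !big_map /= -big_split /= horner_prod.
apply: prodr_gt0 => k _; rewrite !hornerE ltcE /=.
by rewrite !(mul0r, mul1r, mulr0, mulr1, add0r, addr0, subr0, oppr0, opprK); apply/andP; split; [apply/eqP; ring | have := ltr0Sn R k; nra].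
Qed.

Lemma seq_uniform_bound (T : eqType) (s : seq T) (G : T -> R -> R) (k : nat) :
  (forall w, w \in s -> exists M e : R, 0 < e /\
     forall x : R, 0 < x < e -> G w x <= M * x ^+ k) ->
  exists M e : R, 0 < e /\ forall x : R, 0 < x < e -> \sum_(w <- s) G w x <= M * x ^+ k.
Proof.
elim: s => [_|a s IHs Gs].
  by exists 0, 1; split=> // x _; rewrite big_nil mul0r.
have [M1 [e1 [e10 H1]]] := Gs a (mem_head _ _).
have [|M2 [e2 [e20 H2]]] := IHs; first by move=> w ws; apply: Gs; rewrite inE ws orbT.
exists (M1 + M2), (Num.min e1 e2); split; first by rewrite lt_min e10.
move=> x /andP[x0]; rewrite lt_min => /andP[xe1 xe2]; rewrite big_cons mulrDl.
by rewrite lerD ?H1 ?H2 ?x0.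
Qed.

Section Bound.
Variables (F Pc Dh Rh : {poly {poly C}}) (d k : nat) (x0 : R).
Let Dc := F + conj2 F.
Let Nc := 'i%:P%:P * (F - conj2 F).
Hypothesis DcE : Dc = 'X^d * Dh.
Hypothesis Dh0 : (1 < size (Dh`_0)%R)%N.
Hypothesis NcE : Nc - Pc * Dc = 'X^(k + d) * Rh.
Hypothesis x0_gt0 : 0 < x0.
Hypothesis rootsF : forall x : R, 0 < x < x0 ->
  exists2 h, 0 < h & forall l, root F.[x%:C%:P] l -> Im l <= - h.

Let M := \max_(i < size Dh) size (Dh`_i)%R.

Let cabs_x (x : R) : 0 < x -> cabs (x%:C - 0) = x.
Proof. by move=> x0'; rewrite subr0 cabs_real gtr0_norm. Qed.

Lemma near_Dh_root l0 : root Dh`_0 l0 ->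
  exists2 e : R, 0 < e & forall x : R, 0 < x < e ->
    Dh.[x%:C%:P] != 0 /\ exists2 l, root Dh.[x%:C%:P] l & cabs (l - l0) < 1.
Proof.
move=> rl0; have [|l1 l10] := @poly_nonroot _ Dh`_0.
  by rewrite -size_poly_gt0 (ltn_trans _ Dh0).
pose g l := map_poly (horner_eval l) Dh.
have g0 l : (g l).[0] = (Dh`_0).[l] by rewrite horner_coef0 coef_map.
have gE l x : (g l).[x] = Dh.[x%:P].[l] by rewrite -ev_is_map.
have [|e1 /andP[e10 e11] low] := @poly_locally_nonzero _ (g l1) 0; first by rewrite g0.
set q := (1 + cabs (l1 - l0) / 1) ^+ M.
have q0 : 0 < q by rewrite exprn_gt0 // ltr_pwDl // divr_ge0 ?cabs_ge0.
set c := cabs (g l1).[0] / 2 in low.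
have c0 : 0 < c by rewrite divr_gt0 // cabs_gt0 g0.
have [||e2 /andP[e20 e21] small] := @poly_small_at_root _ (g l0) 0 (c / 2 / q).
- by rewrite g0; apply/eqP.
- by apply: divr_gt0 => //; apply: divr_gt0.
exists (Num.min e1 e2); first by rewrite lt_min e10.
move=> x /andP[xx]; rewrite lt_min => /andP[xe1 xe2].
have /low cl : cabs (x%:C - 0) <= e1 by rewrite cabs_x // ltW.
have /small cs : cabs (x%:C - 0) <= e2 by rewrite cabs_x // ltW.
split.
  apply: contraTneq cl => D0; rewrite gE D0 horner0 cabs0 -ltNge //.
apply: (@exists_near_root _ _ l0 l1 1 M) => //; first exact: leqW (size_horner_polyC _ _).
rewrite -!gE -/q; apply: lt_le_trans cl; rewrite ler_pdivlMr // in cs.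
by apply: le_lt_trans cs _; lra.
Qed.

Lemma Dc_horner (x : R) : Dc.[x%:C%:P] = x%:C ^+ d *: Dh.[x%:C%:P].
Proof. by rewrite DcE hornerM hornerXn -polyC_exp mul_polyC. Qed.

Lemma Dh_root_real (x : R) l : 0 < x < x0 -> Dh.[x%:C%:P] != 0 ->
  root Dh.[x%:C%:P] l -> Im l = 0.
Proof.
move=> xx Dx rl; have [h h0 hr] := rootsF xx.
have xd : x%:C ^+ d != 0.
  by rewrite expf_neq0 // eq_complex /= eqxx andbT gt_eqF //; case/andP: xx.
apply: (HB_root_real h0 hr); rewrite -conj2_horner -hornerD -/Dc Dc_horner.
  by rewrite scaler_eq0 negb_or xd.
by rewrite rootZ.
Qed.

(** A root [l] would have a root of some slice [Dh.[x]] at distance less than 1, but those roots are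
    real. Hence [Dh] does not vanish at the nodes when [x = 0], nor for small [x]. *)
Lemma Dh0_nonreal l : 1 <= `|Im l| -> (Dh`_0).[l] != 0.
Proof.
move=> Iml; apply/negP => rl; have [e e0 near] := near_Dh_root rl.
have x00 := x0_gt0; pose x := Num.min e x0 / 2.
have mpos : 0 < Num.min e x0 by rewrite lt_min e0.
have [m1 m2] : 2 * x <= e /\ 2 * x <= x0.
  by rewrite /x mulrC divfK ?pnatr_eq0 // !ge_min !lexx !orbT.
have xpos : 0 < x by rewrite divr_gt0.
have /near[Dx [z rz zl]] : 0 < x < e by lra.
have z0 : Im z = 0 by apply: (@Dh_root_real x) => //; lra.
have := cabs_geIm (z - l); rewrite raddfB /= z0 sub0r normrN; lra.
Qed.

Lemma chart_bound : exists M' e : R, 0 < e /\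
  forall x h : R, 0 < x < e -> 0 < h ->
    (forall l, root F.[x%:C%:P] l -> Im l <= - h) -> h <= M' * x ^+ k.
Proof.
have [l0 rl0] : exists l0, root Dh`_0 l0.
  by apply/closed_rootP; rewrite neq_ltn Dh0 orbT.
have [e1 e10 near] := near_Dh_root rl0.
pose ME := \max_(i < size F) size (F`_i)%R.
pose MP := \max_(i < size Pc) size (Pc`_i)%R.
(* The [2 L] nodes outnumber the sizes of all slices of [F] and [Pc], so one [W] serves every
   [x]. *)
pose L := (ME + MP).+1; pose s := nodes L.
pose W := \prod_(q <- s) ('X - q%:P).
have [MW MW0 Wle] := poly_locally_bounded W l0.
have [w ws|M1 [e2 [e20 sumle]]] := @seq_uniform_bound _ s (fun w (x : R) =>
  cabs ((Nc - Pc * Dc).[x%:C%:P].[w] / Dc.[x%:C%:P].[w] / W^`().[w])) k.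
  have dw : (map_poly (horner_eval w) Dh).[0] != 0.
    by rewrite horner_coef0 coef_map /=; apply/Dh0_nonreal/nodes_Im/ws.
  have [e /andP[e0' e1'] low] := poly_locally_nonzero dw.
  have [B B0 Rle] := poly_locally_bounded (map_poly (horner_eval w) Rh) 0.
  set c := cabs _ / 2 in low; have c0 : 0 < c by rewrite divr_gt0 // cabs_gt0.
  exists (B / c * cabs (W^`().[w])^-1), e; split=> // x /andP[xx xe].
  have cx : cabs (x%:C - 0) <= e by rewrite cabs_x // ltW.
  have := low _ cx; have := Rle _ (le_trans cx e1').
  rewrite -!ev_is_map -![_.[_].[w]]/(ev w _ _) NcE DcE !evM !evXn !evX.
  set r := ev w _ Rh; set t := ev w _ Dh => rB ct.
  have x0' : x%:C != 0 by rewrite eq_complex /= eqxx andbT gt_eqF.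
  have t0 : t != 0 by rewrite -cabs_gt0; apply: lt_le_trans ct.
  have -> : x%:C ^+ (k + d) * r / (x%:C ^+ d * t) = x%:C ^+ k * (r / t).
    by rewrite exprD; field; rewrite t0 expf_neq0.
  rewrite !cabsM cabsX cabs_real gtr0_norm // (cabsV t).
  set v := cabs (_^-1); rewrite [leLHS](_ : _ = cabs r / cabs t * v * x ^+ k); last by ring.
  have xk0 : 0 <= x ^+ k by rewrite exprn_ge0 // ltW.
  rewrite (ler_wpM2r xk0) // ler_wpM2r ?cabs_ge0 //.
  rewrite ler_pM ?cabs_ge0 ?invr_ge0 ?cabs_ge0 // lef_pV2 ?posrE //.
  exact: lt_le_trans ct.
(* [M1] comes from the sum over the nodes, [MW] bounds [W] within distance 1 of [l0], and [ME]
   bounds the size of the slices of [F]. *)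
exists (M1 * MW * ME%:R), (Num.min (Num.min e1 e2) x0); split.
  by rewrite !lt_min e10 e20 x0_gt0.
move=> x h /andP[xx]; rewrite !lt_min => /andP[/andP[xe1 xe2] xx0] h0 hr.
have [|Dx [z rz zl]] := near x; first by rewrite xx.
have xI : 0 < x < x0 by rewrite xx.
have Dx0 : Dc.[x%:C%:P] != 0.
  rewrite Dc_horner scaler_eq0 negb_or Dx andbT expf_neq0 //.
  by rewrite eq_complex /= eqxx andbT gt_eqF.
have rDz : root Dc.[x%:C%:P] z.
  by rewrite Dc_horner /root hornerZ (eqP rz) mulr0.
have szF : (size F.[x%:C%:P] <= ME)%N := size_horner_polyC _ _.
have szP : (size Pc.[x%:C%:P] <= MP)%N := size_horner_polyC _ _.
have szE0 : (0 < size F.[x%:C%:P])%N.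
  rewrite size_poly_gt0; apply: contra_neq Dx0 => F0.
  by rewrite /Dc hornerD conj2_horner F0 map_poly0 addr0.
have Wz : 0 < cabs W.[z].
  rewrite cabs_gt0 -[W.[z] == 0]/(root W z) root_prod_XsubC; apply/negP => /nodes_Im.
  by rewrite (Dh_root_real xI Dx rz) normr0 ler10.
have := @HB_residue_bound _ F.[x%:C%:P] _ h0 hr.
rewrite -conj2_horner -hornerD -/Dc => /(_ Dx0 s Pc.[x%:C%:P] z rDz (uniq_nodes _)).
move=> /(_ _ (@nodes_prod_gt0 L)) HB.
have /HB{HB} HB : forall w, w \in s -> Im w != 0.
  by move=> w /nodes_Im; apply: contraTneq => ->; rewrite normr0 ler10.
have szs : (ME + MP < size s)%N by rewrite size_nodes ltn_addr ?ltnSn.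
have {}HB := HB (leq_ltn_trans (leq_trans szF (leq_addr _ _)) szs)
  (leq_ltn_trans (leq_trans szP (leq_addl _ _)) szs).
have xk : 0 < x < e2 by rewrite xx.
have {HB} : h / (size F.[x%:C%:P])%:R / cabs W.[z] <= M1 * x ^+ k.
  apply: le_trans HB (le_trans _ (sumle x xk)); rewrite le_eqVlt; apply/orP; left.
  apply/eqP/eq_bigr => w _; congr (cabs (_ / _ / _)).
  by rewrite -[Nc - _]/(Nc + - _) !hornerE.
rewrite ler_pdivrMr // ler_pdivrMr ?ltr0n // => /le_trans; apply.
have M1x : 0 <= M1 * x ^+ k.
  apply: le_trans _ (sumle x xk); apply: sumr_ge0 => w _; exact: cabs_ge0.
rewrite [leRHS](_ : _ = M1 * x ^+ k * MW * ME%:R); last by ring.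
apply: ler_pM.
- by apply: mulr_ge0 => //; exact: cabs_ge0.
- exact: ler0n.
- by rewrite (ler_wpM2l M1x) // Wle // ltW.
- by rewrite ler_nat.
Qed.


End Bound.
End Charts.

(** * The contact function *)

Section Companion.
Variable F : fieldType.

Lemma char_poly_companion m (p : {poly F}) : p \is monic -> size p = m.+1 ->
  char_poly (\matrix_(i < m, j < m)
    if i == m.-1 :> nat then - p`_j else (i.+1 == j :> nat)%:R) = p.
Proof.
move=> mp szp; have := companionmxK mp; rewrite /companionmx.
by move: (szp) => /(congr1 predn) /= <-.
Qed.

Lemma horner_char_poly m (M : 'M[F]_m) x : (char_poly M).[x] = \det (x%:M - M).
Proof.
rewrite -[LHS]/(horner_eval x (char_poly M)) -det_map_mx; congr (\det _).
apply/matrixP => i j; rewrite !mxE /= /horner_eval.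
by rewrite hornerD hornerN hornerC hornerMn hornerX.
Qed.

Lemma det_one_sub_scale m (M : 'M[F]_m) (zs : seq F) (s : F) :
  char_poly M = \prod_(z <- zs) ('X - z%:P) ->
  \det (1%:M - s *: M) = \prod_(z <- zs) (1 - s * z).
Proof.
move=> cM; have [->|s0] := eqVneq s 0.
  by rewrite scale0r subr0 det1 big1 // => z _; rewrite mul0r subr0.
have szm : m = size zs.
  by have := congr1 (fun p : {poly F} => (size p).-1) cM; rewrite size_char_poly size_prod_XsubC.
have -> : 1%:M - s *: M = s *: (s^-1%:M - M).
  by rewrite scalerBr scale_scalar_mx mulfV.
have sX : s ^+ m = \prod_(z <- zs) s.
  by rewrite big_const_seq count_predT iter_mulr_1 -szm.
rewrite detZ -horner_char_poly cM horner_prod sX -big_split /=.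
by apply: eq_bigr => z _; rewrite !hornerE mulrBr mulfV.
Qed.

End Companion.

(** Each factor contributes [- q / (1 - q) = 1 - 1 / (1 - q)] to the logarithmic derivative at 1. *)
Lemma deriv_prod_one_sub (F : fieldType) (Q : seq F) : 1 \notin Q ->
  (\prod_(q <- Q) (1 - q *: 'X))^`().[1] =
  (\prod_(q <- Q) (1 - q)) * ((size Q)%:R - \sum_(q <- Q) (1 - q)^-1).
Proof.
elim: Q => [|q Q IHQ]; first by rewrite !big_nil derivC horner0 subr0 mulr0.
rewrite inE negb_or => /andP[q1 /IHQ{}IHQ].
have q0 : 1 - q != 0 by rewrite subr_eq0.
rewrite !big_cons derivM !hornerE IHQ derivB derivC derivZ derivX !hornerE /=.
rewrite horner_prod (eq_bigr (fun q => 1 - q)); last by move=> i _; rewrite !hornerE.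
set S := \sum_(j <- Q) _; set P := \prod_(j <- Q) _; rewrite -natr1.
by field.
Qed.

Section ContactFunction.
Variable R : rcfType.
Local Notation C := R[i].
Implicit Types (PT PP : {poly {poly C}}).

Definition evm (l x : C) : {rmorphism {poly {poly C}} -> C} :=
  horner_eval l \o horner_eval x%:P.

Lemma evmE l x F : evm l x F = ev l x F.
Proof. by []. Qed.


(* [C(t M)] up to a power of the leading coefficient of [PT], where [M] is the
   companion matrix of [PT] and [C] is [PP], both as polynomials in the outer
   variable; its determinant is a multiple of
   [\prod_(k, l) (1 - t * z_k * b_l)] for [z_k] the roots of [PT] and [1 / b_l]
   those of [PP]. *)
Definition contact_mx m PT PP : 'M[{poly {poly C}}]_m.+1 :=
  \sum_(j < m.+2) ((PP`_j * PT`_m.+1 ^+ (m.+1 - j))%:P * 'X^j) *: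
    (\matrix_(i, k) (if i == m :> nat then - PT`_k else
       (i.+1 == k :> nat)%:R * PT`_m.+1)%:P) ^+ j.

Lemma poly_ext (f g : {poly C}) : (forall x, f.[x] = g.[x]) -> f = g.
Proof.
move=> fg; apply/eqP; rewrite -subr_eq0; apply/eqP.
by apply: (poly_eq0_inj_roots (@natr_inj R)) => k; rewrite hornerD hornerN fg subrr.
Qed.

Lemma horner_prod_one_sub (bs : seq C) x :
  (\prod_(b <- bs) (1 - b *: 'X)).[x] = \prod_(b <- bs) (1 - b * x).
Proof. by rewrite horner_prod; apply: eq_bigr => b _; rewrite !hornerE. Qed.

Lemma size_prod_one_sub (bs : seq C) :
  (size (\prod_(b <- bs) (1 - b *: 'X))%R <= (size bs).+1)%N.
Proof.
elim: bs => [|b bs IHb]; first by rewrite big_nil size_poly1.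
rewrite big_cons; apply: leq_trans (size_polyMleq _ _) _.
rewrite -subn1 leq_subLR; apply: (leq_trans (@leq_add _ _ 2 _ _ IHb)); last exact: leqnn.
rewrite (leq_trans (size_polyD _ _)) // size_poly1 geq_max /= size_polyN.
by rewrite (leq_trans (size_scale_leq _ _)) // size_polyX.
Qed.

(** With [M] the companion matrix of the monic slice of [PT], [contact_mx] evaluates to [al ^ m.+1]
    times [q(M)], where [q] is the slice of [PP] at [t 'X]. Since [q] splits into the factors
    [1 - t b 'X], the determinant splits into the [det (1 - t b M)]. *)
Lemma ev_contact_det m PT PP (z t kappa : C) (zs bs : seq C) :
  let al := (PT`_m.+1).[z] in al != 0 -> size zs = m.+1 -> size bs = m.+1 ->
  slice z PT = al *: \prod_(w <- zs) ('X - w%:P) ->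
  slice z PP = kappa *: \prod_(b <- bs) (1 - b *: 'X) ->
  ev z t (\det (contact_mx m PT PP)) =
  (al ^+ m.+1 * kappa) ^+ m.+1 * \prod_(b <- bs) \prod_(w <- zs) (1 - t * b * w).
Proof.
move=> al al0 szz szb PTE PPE.
pose pm := \prod_(w <- zs) ('X - w%:P).
pose M : 'M[C]_m.+1 := \matrix_(i, k)
  if i == m :> nat then - pm`_k else (i.+1 == k :> nat)%:R.
have cM : char_poly M = pm.
  by apply: char_poly_companion; rewrite ?monic_prod_XsubC // size_prod_XsubC szz.
pose q := \sum_(j < m.+2) ((PP`_j).[z] * t ^+ j) *: 'X^j.
have qE : q = kappa *: \prod_(b <- bs) (1 - (t * b) *: 'X).
  apply: poly_ext => x; rewrite hornerZ horner_prod /q horner_sum.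
  transitivity ((slice z PP).[t * x]).
    rewrite (@horner_coef_wide _ m.+2); last first.
      by rewrite PPE (leq_trans (size_scale_leq _ _)) // -szb size_prod_one_sub.
    by apply: eq_bigr => j _; rewrite hornerZ hornerXn coef_map exprMn mulrA.
  rewrite PPE hornerZ horner_prod_one_sub; congr (_ * _).
  by apply: eq_bigr => b _; rewrite hornerD hornerN hornerC hornerZ hornerX; congr (1 - _); ring.
have -> : ev z t (\det (contact_mx m PT PP)) = \det (al ^+ m.+1 *: horner_mx M q).
  rewrite -evmE -det_map_mx; congr (\det _).
  rewrite /contact_mx rmorph_sum /q rmorph_sum scaler_sumr; apply: eq_bigr => j _.
  rewrite /= map_mxZ rmorphXn /= linearZ /= rmorphXn /= horner_mx_X.
  have -> : map_mx (evm z t) (\matrix_(i, k) (if i == m :> nat then - PT`_k else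
       (i.+1 == k :> nat)%:R * PT`_m.+1)%:P) = al *: M.
    apply/matrixP => i k; rewrite !mxE evmE evC; case: ifP => _.
      rewrite hornerN mulrN; congr (- _).
      by have := congr1 (fun p : {poly C} => p`_k) PTE; rewrite coef_map coefZ.
    by rewrite hornerM -polyC_natr hornerC mulrC.
  rewrite exprZn !scalerA; congr (_ *: _).
  rewrite -[horner_eval _ _]/(ev z t _) evM evXn evX evC hornerM horner_exp -/al.
  have jm : (j <= m.+1)%N by rewrite -ltnS.
  have -> : al ^+ m.+1 = al ^+ (m.+1 - j) * al ^+ j by rewrite -exprD subnK.
  by ring.
rewrite detZ qE linearZ /= detZ mulrA -exprMn; congr (_ * _).
rewrite rmorph_prod (big_morph (fun A : 'M_m.+1 => \det A) (@det_mulmx _ _) (det1 _ _)).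
apply: eq_bigr => b _; rewrite -[_ (1 - _)]/(horner_mx M _) rmorphB rmorph1 /=.
by rewrite linearZ /= horner_mx_X -(det_one_sub_scale _ cM).
Qed.

Definition contact_den m PT PP : {poly C} := (\det (contact_mx m PT PP)).[1].
(** The combination is dictated by [deriv_prod_one_sub], with [m.+1 * m.+1] pairs of roots: it makes
    [contact_num / contact_den] the sum of all [1 / (1 - b w)]. *)
Definition contact_num m PT PP : {poly C} :=
  (m.+1 * m.+1)%:R * contact_den m PT PP - (\det (contact_mx m PT PP))^`().[1].

Lemma horner_contact_den m PT PP (z kappa : C) (zs bs : seq C) :
  let al := (PT`_m.+1).[z] in al != 0 -> size zs = m.+1 -> size bs = m.+1 ->
  slice z PT = al *: \prod_(w <- zs) ('X - w%:P) ->
  slice z PP = kappa *: \prod_(b <- bs) (1 - b *: 'X) ->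
  (contact_den m PT PP).[z] =
  (al ^+ m.+1 * kappa) ^+ m.+1 * \prod_(b <- bs) \prod_(w <- zs) (1 - b * w).
Proof.
move=> al al0 szz szb PTE PPE; have := ev_contact_det 1 al0 szz szb PTE PPE.
rewrite /ev polyC1 => ->; congr (_ * _); apply: eq_bigr => b _.
by apply: eq_bigr => w _; rewrite mul1r.
Qed.

Lemma horner_contact_num m PT PP (z kappa : C) (zs bs : seq C) :
  let al := (PT`_m.+1).[z] in al != 0 -> size zs = m.+1 -> size bs = m.+1 ->
  slice z PT = al *: \prod_(w <- zs) ('X - w%:P) ->
  slice z PP = kappa *: \prod_(b <- bs) (1 - b *: 'X) ->
  (forall b w, b \in bs -> w \in zs -> b * w != 1) ->
  (contact_num m PT PP).[z] = (contact_den m PT PP).[z] *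
    \sum_(b <- bs) \sum_(w <- zs) (1 - b * w)^-1.
Proof.
move=> al al0 szz szb PTE PPE bw1.
pose Q := [seq b * w | b <- bs, w <- zs].
set K := (al ^+ m.+1 * kappa) ^+ m.+1.
have dE : slice z (\det (contact_mx m PT PP)) = K *: \prod_(q <- Q) (1 - q *: 'X).
  apply: poly_ext => t; rewrite -ev_is_map (ev_contact_det t al0 szz szb PTE PPE).
  rewrite hornerZ horner_prod_one_sub -/K big_allpairs_dep; congr (_ * _).
  by apply: eq_bigr => b _; apply: eq_bigr => w _; rewrite -mulrA [t * _]mulrC.
have Q1 : 1 \notin Q.
  by apply/allpairsP => -[[b w] /= [bb ww e]]; have := bw1 b w bb ww; rewrite -e eqxx.
rewrite /contact_num hornerD hornerN hornerM (horner_contact_den al0 szz szb PTE PPE) -/al -/K.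
have -> : ((\det (contact_mx m PT PP))^`().[1]).[z] =
    K * (\prod_(q <- Q) (1 - q) * ((size Q)%:R - \sum_(q <- Q) (1 - q)^-1)).
  rewrite -deriv_prod_one_sub // -hornerZ -derivZ -dE deriv_map.
  by rewrite -ev_is_map /ev polyC1.
have -> : \prod_(q <- Q) (1 - q) = \prod_(b <- bs) \prod_(w <- zs) (1 - b * w).
  by rewrite big_allpairs_dep.
have -> : \sum_(q <- Q) (1 - q)^-1 = \sum_(b <- bs) \sum_(w <- zs) (1 - b * w)^-1.
  by rewrite big_allpairs_dep.
rewrite size_allpairs szz szb -polyC_natr hornerC; ring.
Qed.

(** All terms have nonnegative real part, so the sum dominates the diagonal term of [z0], namely
    [1 / (1 - |z0|^2) = 1 / (e (1 + |z0|))], which is at least [1 / (2 e)]. Conversely every term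
    has modulus at most [1 / e]. *)
Lemma cabs_contact_sum (zs : seq C) (e : R) z0 : z0 \in zs -> 0 < e ->
  e = 1 - cabs z0 -> (forall z, z \in zs -> e <= 1 - cabs z) ->
  let H := \sum_(b <- [seq z^* | z <- zs]) \sum_(w <- zs) (1 - b * w)^-1 in
  1 / 2 <= e * cabs H <= (size zs * size zs)%:R.
Proof.
move=> z0s e0 ez0 ez; cbv zeta; set H := \sum_(b <- map _ _) _.
have low z w : z \in zs -> w \in zs -> e <= cabs (1 - z^* * w).
  move=> /ez ze /ez we; have := le_cabsB 1 (z^* * w); rewrite cabs1 cabsM cabsJ.
  have : cabs z * cabs w <= cabs z * 1 by rewrite ler_wpM2l ?cabs_ge0 //; lra.
  lra.
have re z w : z \in zs -> w \in zs -> 0 <= Re (1 - z^* * w)^-1.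
  move=> zz ww; have lw := low z w zz ww.
  have : Re (z^* * w) <= 1.
    apply: le_trans (ler_norm _) (le_trans (cabs_geRe _) _).
    rewrite cabsM cabsJ mulr_ile1 ?cabs_ge0 //; have := ez z zz; have := ez w ww; lra.
  case: (z^* * w) => a b /= a1; apply: divr_ge0; first lra.
  by rewrite addr_ge0 ?sqr_ge0.
have HE : H = \sum_(z <- zs) \sum_(w <- zs) (1 - z^* * w)^-1 by rewrite /H big_map.
have ReS (T : Type) (s : seq T) (G : T -> C) :
    Re (\sum_(i <- s) G i) = \sum_(i <- s) Re (G i).
  by elim: s => [|i s IHs]; rewrite ?big_nil // !big_cons -IHs; case: (G i); case: (\sum_(j <- s) _).
apply/andP; split.
  apply: le_trans (_ : e * Re H <= _); last first.
    by rewrite ler_wpM2l ?(ltW e0) // (le_trans (ler_norm _)) // cabs_geRe.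
  have : Re (1 - z0^* * z0)^-1 <= Re H.
    rewrite HE ReS (big_rem z0) //= ReS (big_rem z0) //= -addrA lerDl addr_ge0 //.
      by rewrite big_seq sumr_ge0 // => w /mem_rem ww; apply: re.
    rewrite big_seq sumr_ge0 // => z /mem_rem zz; rewrite ReS big_seq.
    by rewrite sumr_ge0 // => w ww; apply: re.
  rewrite mulrC mulcJ_cabs -rmorphB -fmorphV /=.
  have c0 := cabs_ge0 z0; have -> : 1 - cabs z0 ^+ 2 = e * (1 + cabs z0) by rewrite ez0; ring.
  rewrite invfM => le1; apply: le_trans (ler_wpM2l (ltW e0) le1).
  rewrite mulrA mulfV ?gt_eqF // mul1r div1r lef_pV2 ?posrE; lra.
rewrite mulrC -ler_pdivlMr // HE.
apply: le_trans (cabs_sum _ _ _) _.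
have -> : (size zs * size zs)%:R / e = \sum_(z <- zs) \sum_(w <- zs) e^-1.
  rewrite !big_const_seq !count_predT !iter_addr_0 -mulrnA.
  by rewrite -[RHS]mulr_natr mulrC.
rewrite !big_seq; apply: ler_sum => z zz; apply: le_trans (cabs_sum _ _ _) _.
rewrite !big_seq; apply: ler_sum => w ww; rewrite cabsV lef_pV2 ?posrE //; first exact: low.
exact: lt_le_trans (low z w zz ww).
Qed.

Lemma poly_local_order (f : {poly C}) (z0 : C) : f != 0 ->
  exists a : nat, exists c1 c2 e : R, [/\ 0 < c1, 0 < c2, 0 < e &
    forall z, cabs (z - z0) < e ->
      c1 * cabs (z - z0) ^+ a <= cabs f.[z] <= c2 * cabs (z - z0) ^+ a].
Proof.
move=> f0; have [a [g rg fE]] := multiplicity_XsubC f z0.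
rewrite f0 /= in rg.
have [e /andP[e0 e1] low] := poly_locally_nonzero rg.
have [B B0 up] := poly_locally_bounded g z0.
exists a, (cabs g.[z0] / 2), B, e; split=> //.
  by rewrite divr_gt0 // cabs_gt0.
move=> z ze; rewrite fE hornerM horner_exp hornerXsubC cabsM cabsX.
have za : 0 <= cabs (z - z0) ^+ a by rewrite exprn_ge0 ?cabs_ge0.
by rewrite !(ler_wpM2r za) // ?up ?low ?(le_trans (ltW ze)) // ltW.
Qed.
End ContactFunction.

(** * Polynomials without zeros in the bidisk *)

Section Gauss.
Variable R : rcfType.
Local Notation C := R[i].
Implicit Types (F U V : {poly {poly C}}).

Lemma slice_eq0 (z : C) F : slice z F = 0 -> exists V, F = ('X - z%:P)%:P * V.
Proof.
move=> F0; exists (map_poly (fun c => c %/ ('X - z%:P)) F); apply/polyP => i.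
rewrite coefCM coef_map_id0 ?div0p // mulrC divpK // dvdp_XsubCl.
by have := congr1 (fun p : {poly C} => p`_i) F0; rewrite coef_map coef0 /root => /eqP.
Qed.

(** If a slice of [F] vanishes at [z], then [z] is a root of the leading coefficient and ['X - z]
    divides [F]. Dividing it out lowers the degree of the leading coefficient, so the process
    stops. *)
Lemma primitive_part F : F != 0 -> exists2 h : {poly C}, h != 0 &
  exists2 U, F = h%:P * U & forall z, slice z U != 0.
Proof.
move: {2}(size (lead_coef F)).+1 (ltnSn (size (lead_coef F))) => k.
elim: k F => // k IHk F szF F0.
have lF0 : lead_coef F != 0 by rewrite lead_coef_eq0.
have [r rE] := complex_poly_normal (lead_coef F).
have lE z : slice z F = 0 -> z \in r.
  move=> Fz; rewrite -(root_prod _ lF0 rE).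
  have := congr1 (fun p : {poly C} => p`_(size F).-1) Fz.
  by rewrite coef_map coef0 /root => /eqP.
have [/hasP[z zr /eqP Fz]|/hasPn none] := boolP (has (fun z => slice z F == 0) r).
  have [V VE] := slice_eq0 Fz.
  have V0 : V != 0 by apply: contra_neq F0 => V0; rewrite VE V0 mulr0.
  have X0 : 'X - z%:P != 0 by rewrite polyXsubC_eq0.
  have [|h h0 [U UE prim]] := IHk V _ V0.
    move: szF; rewrite VE lead_coefM lead_coefC size_mul ?lead_coef_eq0 //.
    by rewrite size_XsubC add2n /= ltnS.
  exists (('X - z%:P) * h); first by rewrite mulf_neq0.
  by exists U => //; rewrite VE UE rmorphM /= mulrA.
exists 1; first exact: oner_neq0.
exists F => [|z]; first by rewrite mul1r.
by apply/negP => /eqP Fz; have := none z (lE z Fz); rewrite Fz eqxx.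
Qed.

(** Gauss' lemma: the linear factors of [c] are removed one by one. Each divides [q U], hence [q],
    since no slice of [U] vanishes. *)
Lemma primitive_cancel (c : {poly C}) F q U : c != 0 ->
  (forall z, slice z U != 0) -> c%:P * F = q * U -> exists V, F = U * V.
Proof.
move: {2}(size c).+1 (ltnSn (size c)) => k; elim: k c q => // k IHk c q szc c0 prim cF.
have [sc|sc] := boolP (size c == 1%N).
  have /size_poly1P[c1 c10 cE] := sc.
  exists (c1^-1%:P%:P * q); rewrite mulrC -mulrA -cF cE mulrA -!rmorphM /= mulVf //.
  by rewrite mul1r.
have /closed_rootP[z /factor_theorem[c' c'E]] := sc.
have : slice z (q * U) = 0.
  by rewrite -cF rmorphM /= map_polyC /= /horner_eval c'E !hornerE subrr mulr0 mul0r.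
rewrite rmorphM /= => /eqP; rewrite mulf_eq0 (negbTE (prim z)) orbF => /eqP.
move=> /slice_eq0[q' q'E]; have X0 : 'X - z%:P != 0 by rewrite polyXsubC_eq0.
have c'0 : c' != 0 by apply: contra_neq c0 => c'0; rewrite c'E c'0 mul0r.
apply: (IHk c' q') => //.
  by move: szc; rewrite c'E size_mul // size_XsubC addn2 /= ltnS.
apply: (@mulfI _ ('X - z%:P)%:P); first by rewrite polyC_eq0.
by rewrite !mulrA -q'E -cF c'E; congr (_ * _); rewrite -rmorphM mulrC.
Qed.

(** A zero resultant gives a gcd of positive degree, up to factors in the inner variable alone; its
    primitive part [U] divides both polynomials exactly. [U] takes two values on one slice where its
    leading coefficient survives: that slice has a root and a point that is not a root. *)
Lemma common_factor F1 F2 : F1 != 0 -> F2 != 0 -> resultant F1 F2 = 0 ->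
  exists U V1 V2, [/\ F1 = U * V1, F2 = U * V2 &
     exists z1 z2 w1 w2, ev z2 z1 U <> ev w2 w1 U].
Proof.
move=> F10 F20 /eqP; rewrite resultant_eq0; set g := gcdp F1 F2 => szg.
have g0 : g != 0 by rewrite -size_poly_gt0 (ltn_trans _ szg).
have [h h0 [U UE prim]] := primitive_part g0.
have fac F : g %| F -> exists V, F = U * V.
  case/Pdiv.Idomain.dvdpP => -[c q] /= c0 cF.
  apply: (@primitive_cancel c F (q * h%:P)) => //.
  by rewrite mul_polyC cF UE mulrA.
have [V1 V1E] := fac F1 (dvdp_gcdl _ _).
have [V2 V2E] := fac F2 (dvdp_gcdr _ _).
exists U, V1, V2; split=> //.
have szU : (1 < size U)%N by move: szg; rewrite UE size_Cmul.
have U0 : lead_coef U != 0 by rewrite lead_coef_eq0 -size_poly_gt0 (ltn_trans _ szU).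
have [z zU] := poly_nonroot U0.
have szs : size (slice z U) = size U by rewrite size_map_poly_id0.
have /closed_rootP[z1 rz1] : size (slice z U) != 1%N by rewrite szs neq_ltn szU orbT.
have [z2 nz2] := poly_nonroot (prim z).
exists z1, z, z2, z; rewrite !ev_is_map (eqP rz1) => e.
by rewrite -e eqxx in nz2.
Qed.

End Gauss.

(** * The reflected polynomial and zeros over the circle *)

Section Bidisk.
Variable R : rcfType.
Local Notation C := R[i].
Variables (m n : nat).
Implicit Types a : nat -> nat -> C.

(** The outer variable is [z1], so [slice z] fixes [z2 = z] and leaves a polynomial in [z1]. *)
Definition pol a : {poly {poly C}} := \poly_(i < m.+1) \poly_(j < n.+1) a i j.
Definition refl a i j : C := (a (m - i)%N (n - j)%N)^*.

Lemma ev_pol a z1 z2 :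
  ev z2 z1 (pol a) = \sum_(i < m.+1) \sum_(j < n.+1) a i j * (z1 ^+ i * z2 ^+ j).
Proof.
rewrite /ev /pol horner_poly horner_sum; apply: eq_bigr => i _.
rewrite hornerM -polyC_exp hornerC horner_poly mulr_suml; apply: eq_bigr => j _.
by ring.
Qed.

Lemma coef_pol_ev a i z : (i < m.+1)%N ->
  ((pol a)`_i).[z] = \sum_(j < n.+1) a i j * z ^+ j.
Proof. by move=> im; rewrite coef_poly im horner_poly. Qed.

Lemma conj_unit (z : C) : cabs z = 1 -> z^* = z^-1.
Proof.
move=> z1; have := mulcJ_cabs z; rewrite z1 expr1n /= => zz.
have z0 : z != 0 by rewrite -cabs_gt0 z1.
by apply: (mulfI z0); rewrite zz mulfV.
Qed.

Lemma coef_refl a i z : (i < m.+1)%N -> cabs z = 1 ->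
  ((pol (refl a))`_i).[z] = z ^+ n * (((pol a)`_(m - i)).[z])^*.
Proof.
move=> im z1; have z0 : z != 0 by rewrite -cabs_gt0 z1.
rewrite !coef_pol_ev ?ltnS ?leq_subr // rmorph_sum mulr_sumr /=.
rewrite (reindex_inj rev_ord_inj) /=; apply: eq_bigr => j _.
have jn : (j <= n)%N by rewrite -ltnS.
rewrite /refl subSS subKn // rmorphM rmorphXn /= (conj_unit z1) mulrCA; congr (_ * _).
by rewrite exprVn -exprB // unitfE.
Qed.

Lemma ev_refl a z zeta : cabs zeta = 1 -> z != 0 ->
  ev zeta z (pol (refl a)) = zeta ^+ n * z ^+ m * (ev zeta (z^*)^-1 (pol a))^*.
Proof.
move=> z1 z0; have sz b : (size (slice zeta (pol b)) <= m.+1)%N.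
  by rewrite (leq_trans (size_poly _ _)) // size_poly.
rewrite !ev_is_map !(horner_coef_wide _ (sz _)) rmorph_sum mulr_sumr /=.
rewrite (reindex_inj rev_ord_inj) /=; apply: eq_bigr => i _.
have im : (i <= m)%N by rewrite -ltnS.
rewrite !coef_map /= subSS /horner_eval coef_refl ?ltnS ?leq_subr // subKn //.
rewrite rmorphM rmorphXn /= conjc_inv conjcK -!mulrA; congr (_ * _).
by rewrite mulrCA; congr (_ * _); rewrite exprVn -exprB // unitfE.
Qed.

Variable a : nat -> nat -> C.
Let P := pol a.
Let Q := pol (refl a).
Hypothesis no_zero : forall z1 z2, cabs z1 < 1 -> cabs z2 < 1 -> ev z2 z1 P != 0.
Hypothesis ator : forall U V1 V2, P = U * V1 -> Q = U * V2 ->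
  forall z1 z2 w1 w2, ev z2 z1 U = ev w2 w1 U.

(** If the slice of [P] vanished, so would that of the reflection [Q], and [z2 - z] would be a
    common factor. *)
Lemma slice_P_neq0 z : cabs z = 1 -> slice z P != 0.
Proof.
move=> z1; apply/negP => /eqP Pz.
have Qz : slice z Q = 0.
  apply: (@poly_eq0_inj_roots _ _ (fun k : nat => k.+1%:R)) => [k l /eqP|k].
    by rewrite eqr_nat eqSS => /eqP.
  rewrite -ev_is_map ev_refl ?pnatr_eq0 // ev_is_map -/P Pz horner0 rmorph0.
  by rewrite mulr0.
have [V1 V1E] := slice_eq0 Pz; have [V2 V2E] := slice_eq0 Qz.
have := ator V1E V2E 0 z 0 (z + 1); rewrite !evC !hornerE subrr (addrC z) addrK => /eqP.
by rewrite eq_sym oner_eq0.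
Qed.

(** A Hurwitz argument. Moving [z] radially inwards to [y] gives a slice without roots in the disk,
    so all its roots are at distance at least [rho] from [z0]. Yet its value at [z0] is arbitrarily
    small while its value at [w] is bounded below, against [cabs_horner_far_roots]. *)
Lemma P_neq0_disk_circle z0 z : cabs z0 < 1 -> cabs z = 1 -> ev z z0 P != 0.
Proof.
move=> z01 z1; apply/negP => /eqP Pz.
have [w wz] := poly_nonroot (slice_P_neq0 z1); rewrite -ev_is_map in wz.
pose h0 := P.[z0%:P]; pose h1 := P.[w%:P].
have [e1 /andP[e10 e11] low] := @poly_locally_nonzero _ h1 z wz.
set rho := 1 - cabs z0; have rho0 : 0 < rho by rewrite /rho; lra.
set q := (1 + cabs (w - z0) / rho) ^+ m.
have q0 : 0 < q by rewrite exprn_gt0 // ltr_pwDl // divr_ge0 ?cabs_ge0 // ltW.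
set c := cabs h1.[z] / 2 in low; have c0 : 0 < c by rewrite divr_gt0 // cabs_gt0.
have [|e2 /andP[e20 e21] small] := @poly_small_at_root _ h0 z (c / 2 / q) Pz.
  by apply: divr_gt0 => //; apply: divr_gt0.
pose e := Num.min e1 e2; have e0 : 0 < e by rewrite lt_min e10.
have [ee1 ee2] : e <= e1 /\ e <= e2 by rewrite !ge_min !lexx orbT.
pose y : C := (1 - e)%:C * z.
have cy : cabs (y - z) = e.
  have -> : y - z = - (e%:C * z) by rewrite /y rmorphB /=; ring.
  by rewrite cabsN cabsM cabs_real z1 mulr1 gtr0_norm.
have y1 : cabs y < 1.
  by rewrite cabsM cabs_real z1 mulr1 ger0_norm; lra.
have lo : c <= cabs h1.[y] by apply: low; rewrite cy.
have sm : cabs h0.[y] <= c / 2 / q by apply: small; rewrite cy.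
have : cabs h1.[y] <= cabs h0.[y] * q.
  rewrite -[h1.[y]]/(ev y w P) -[h0.[y]]/(ev y z0 P) !ev_is_map.
  apply: cabs_horner_far_roots => //.
    by rewrite (leq_trans (size_poly _ _)) // size_poly.
  move=> t; rewrite /root -ev_is_map => Pt.
  have : 1 <= cabs t by rewrite leNgt; apply: contraTN Pt => t1; apply: no_zero.
  have := le_cabsB t z0; rewrite /rho; lra.
rewrite ler_pdivlMr // in sm; lra.
Qed.

(** Up to a unimodular factor this is the conjugate of [p(0, z)]. All slices of [Q] over the circle
    thus have exact degree [m]. *)
Lemma lead_Q_neq0 z : cabs z = 1 -> (Q`_m).[z] != 0.
Proof.
move=> z1; have z0 : z != 0 by rewrite -cabs_gt0 z1.
rewrite coef_refl // subnn mulf_neq0 ?expf_neq0 // conjc_eq0.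
have := @P_neq0_disk_circle 0 z; rewrite cabs0 ltr01 => /(_ isT z1).
by rewrite ev_is_map horner_coef0 coef_map.
Qed.

Lemma Q_root_disk z w : cabs z = 1 -> ev z w Q = 0 -> cabs w <= 1.
Proof.
move=> z1 Qw; rewrite leNgt; apply/negP => w1.
have w0 : w != 0 by rewrite -cabs_gt0; lra.
have z0 : z != 0 by rewrite -cabs_gt0 z1.
move/eqP: Qw; rewrite ev_refl // !mulf_eq0 !expf_eq0 (negbTE z0) (negbTE w0) !andbF /=.
rewrite conjc_eq0; apply/negP/P_neq0_disk_circle => //.
by rewrite cabsV cabsJ invf_lt1 //; lra.
Qed.

(** The zeros of [Q] are listed with multiplicity, and the formula for [P] is the reflection of the
    one for [Q], verified at the positive integers. *)
Lemma slices_normal z : cabs z = 1 -> exists zs : seq C,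
  [/\ size zs = m, slice z Q = (Q`_m).[z] *: \prod_(w <- zs) ('X - w%:P) &
      slice z P = (z ^+ n * ((Q`_m).[z])^*) *: \prod_(b <- [seq w^* | w <- zs]) (1 - b *: 'X)].
Proof.
move=> z1; have al0 := lead_Q_neq0 z1; set al := (Q`_m).[z] in al0 *.
have szQ : size (slice z Q) = m.+1.
  apply/eqP; rewrite eqn_leq (leq_trans (size_poly _ _)) ?size_poly //= ltnNge.
  by apply/negP => /leq_sizeP/(_ m (leqnn m)); rewrite coef_map /= => /eqP; apply/negP.
have Q0 : slice z Q != 0 by rewrite -size_poly_gt0 szQ.
have lQ : lead_coef (slice z Q) = al by rewrite /lead_coef szQ coef_map.
have [zs zsE] := complex_poly_normal (slice z Q); rewrite lQ in zsE.
exists zs; split=> //.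
  by move: szQ; rewrite zsE size_scale // size_prod_XsubC => -[].
have szzs : size zs = m by move: szQ; rewrite zsE size_scale // size_prod_XsubC => -[].
apply/eqP; rewrite -subr_eq0; apply/eqP.
apply: (@poly_eq0_inj_roots _ _ (fun k : nat => k.+1%:R)) => [k l /eqP|k].
  by rewrite eqr_nat eqSS => /eqP.
set x : C := k.+1%:R; have x0 : x != 0 by rewrite pnatr_eq0.
have xc : x^* = x by rewrite conjc_nat.
have z0 : z != 0 by rewrite -cabs_gt0 z1.
apply/eqP; rewrite hornerD hornerN subr_eq0 hornerZ horner_prod_one_sub big_map.
have := @ev_refl a x^-1 z z1; rewrite invr_eq0 => /(_ x0).
rewrite conjc_inv invrK xc -/P -/Q !ev_is_map zsE hornerZ horner_prod => e.
apply/eqP; apply: (can_inj (@conjcK R)); rewrite !rmorphM rmorph_prod /= conjcK.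
apply: (@mulfI _ (z ^+ n * x^-1 ^+ m)); first by rewrite mulf_neq0 ?expf_neq0 ?invr_eq0.
rewrite -e rmorphXn /= (conj_unit z1) -szzs.
have -> : z ^+ n * x^-1 ^+ size zs * (z^-1 ^+ n * al * \prod_(w <- zs) (1 - w^* * x)^*) =
  al * (x^-1 ^+ size zs * \prod_(w <- zs) (1 - w^* * x)^*).
  rewrite (exprVn z); have zn0 : z ^+ n != 0 by rewrite expf_neq0.
  by move: (z ^+ n) zn0 (x^-1 ^+ _) (\prod_(w <- zs) _) => A A0 B T; field.
congr (_ * _); have -> : x^-1 ^+ size zs = \prod_(w <- zs) x^-1.
  by rewrite big_const_seq count_predT iter_mulr_1.
rewrite -big_split /=; apply: eq_bigr => w _; rewrite !hornerE.
by rewrite rmorphB rmorph1 rmorphM /= conjcK xc mulrBr mulr1 mulrCA mulVf // mulr1.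
Qed.

End Bidisk.

(** * The Cayley transform on the real line *)

Section Beta.
Variable R : rcfType.
Local Notation C := R[i].

Definition beta (w : C) : C := (1 + 'i * w) / (1 - 'i * w).

Lemma real_den_neq0 (x : R) : 1 - 'i * x%:C != 0.
Proof. by rewrite eq_complex /= !(mul0r, mul1r, mulr0, subr0, oppr0, addr0, add0r) oner_eq0. Qed.

Lemma cabs_beta_real (x : R) : cabs (beta x%:C) = 1.
Proof.
rewrite cabsM cabsV -[1 + _](_ : (1 - 'i * x%:C)^* = _).
  by rewrite cabsJ mulfV // gt_eqF // cabs_gt0 real_den_neq0.
by apply/eqP; rewrite eq_complex /=; apply/andP; split; apply/eqP; ring.
Qed.

Lemma beta_inj_real (x y : R) : beta x%:C = beta y%:C -> x = y.
Proof.
have e (t : R) : beta t%:C = 2 / (1 - 'i * t%:C) - 1.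
  by rewrite /beta; field; rewrite real_den_neq0.
have x0 := real_den_neq0 x; have y0 := real_den_neq0 y.
rewrite !e => /addIr /(mulfI _); rewrite pnatr_eq0 => /(_ isT)/invr_inj/addrI/oppr_inj.
by move/(congr1 (@complex.Im R)); rewrite /= !mul0r !mul1r !add0r.
Qed.

End Beta.

Lemma seq_max_cabs (R : rcfType) (s : seq R[i]) : (0 < size s)%N ->
  exists2 z, z \in s & forall w, w \in s -> cabs w <= cabs z.
Proof.
elim: s => // a [|b s] IHs _.
  by exists a; rewrite ?mem_head // => w; rewrite inE => /eqP ->.
have [//|z zs zmax] := IHs.
have [az|za] := leP (cabs a) (cabs z).
  by exists z => [|w]; rewrite inE ?zs ?orbT // => /orP[/eqP -> //|/zmax].
exists a => [|w]; rewrite ?mem_head // inE => /orP[/eqP -> //|/zmax wz].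
exact: le_trans wz (ltW za).
Qed.

(** * The distance from the circle to the zeros of the reflection *)

Section Contact.
Variable R : rcfType.
Local Notation C := R[i].
Variables (m n : nat) (a : nat -> nat -> C).
Let P := pol m.+1 n a.
Let Q := pol m.+1 n (refl m.+1 n a).
Hypothesis no_zero : forall z1 z2, cabs z1 < 1 -> cabs z2 < 1 -> ev z2 z1 P != 0.
Hypothesis ator : forall U V1 V2, P = U * V1 -> Q = U * V2 ->
  forall z1 z2 w1 w2, ev z2 z1 U = ev w2 w1 U.
Let u := contact_num m Q P.
Let v := contact_den m Q P.

Lemma slices_normal_roots z zs : cabs z = 1 ->
  slice z Q = (Q`_m.+1).[z] *: \prod_(w <- zs) ('X - w%:P) ->
  forall w, (ev z w Q == 0) = (w \in zs).
Proof.
move=> z1 zsE w; rewrite ev_is_map zsE hornerZ mulf_eq0.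
by rewrite (negbTE (lead_Q_neq0 no_zero ator z1)) /= -rootE root_prod_XsubC.
Qed.

Lemma contact_den_neq0 z zs : cabs z = 1 -> size zs = m.+1 ->
  slice z Q = (Q`_m.+1).[z] *: \prod_(w <- zs) ('X - w%:P) ->
  slice z P = (z ^+ n * ((Q`_m.+1).[z])^*) *:
    \prod_(b <- [seq w^* | w <- zs]) (1 - b *: 'X) ->
  (v.[z] != 0) = all (fun w => cabs w < 1) zs.
Proof.
move=> z1 szz QE PE; have al0 := lead_Q_neq0 no_zero ator z1.
have z0 : z != 0 by rewrite -cabs_gt0 z1.
have le1 w : w \in zs -> cabs w <= 1.
  by rewrite -(slices_normal_roots z1 QE) => /eqP; apply: Q_root_disk.
rewrite /v (horner_contact_den al0 szz _ QE PE) ?size_map //.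
set K := _ ^+ m.+1; have K0 : K != 0.
  by rewrite expf_neq0 // !mulf_neq0 ?expf_neq0 // conjc_eq0.
rewrite mulf_eq0 (negbTE K0) /= big_map; apply/idP/allP => [nz w ws|lt1].
  rewrite lt_neqAle le1 // andbT; apply: contra nz => /eqP w1.
  rewrite prodf_seq_eq0; apply/hasP; exists w => //=.
  rewrite prodf_seq_eq0; apply/hasP; exists w => //=.
  by rewrite mulrC mulcJ_cabs w1 expr1n subrr.
rewrite prodf_seq_neq0; apply/allP => w ws /=.
rewrite prodf_seq_neq0; apply/allP => y ys /=.
rewrite subr_eq0; apply/negP => /eqP/(congr1 (@cabs R)); rewrite cabs1 cabsM cabsJ.
have := lt1 w ws; have := lt1 y ys; have := cabs_ge0 w; have := cabs_ge0 y; nra.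
Qed.

Lemma Q_eq0_circle z w : cabs z = 1 -> cabs w = 1 -> (ev z w Q == 0) = (ev z w P == 0).
Proof.
move=> z1 w1; have z0 : z != 0 by rewrite -cabs_gt0 z1.
have w0 : w != 0 by rewrite -cabs_gt0 w1.
rewrite ev_refl // (conj_unit w1) invrK !mulf_eq0 !expf_eq0 (negbTE z0) (negbTE w0).
by rewrite !andbF /= conjc_eq0.
Qed.

(** Otherwise [P] and [Q] have a common zero over every point of the circle. The resultant, a
    combination of [P] and [Q], then vanishes at infinitely many points, and [common_factor]
    contradicts the atorality hypothesis. *)
Lemma contact_den_nonzero : v != 0.
Proof.
apply/negP => /eqP v0.
have sing z : cabs z = 1 -> exists2 w, ev z w P = 0 & ev z w Q = 0.
  move=> z1; have [zs [szz QE PE]] := slices_normal no_zero ator z1.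
  have := contact_den_neq0 z1 szz QE PE; rewrite v0 horner0 eqxx => /esym/allPn[w ws w1].
  have Qw : ev z w Q = 0 by apply/eqP; rewrite (slices_normal_roots z1 QE).
  exists w => //; apply/eqP; rewrite -Q_eq0_circle ?Qw //.
  by apply/eqP; rewrite eq_le (Q_root_disk no_zero ator z1 Qw) leNgt.
pose zk (k : nat) : C := beta (k%:R : R)%:C.
have zk1 k : cabs (zk k) = 1 by exact: cabs_beta_real.
have zk_inj : injective zk by move=> k l /beta_inj_real/eqP; rewrite eqr_nat => /eqP.
have P0 : P != 0.
  by apply/negP => /eqP P0; have := @no_zero 0 0; rewrite cabs0 ltr01 P0 ev_is_map map_poly0 horner0 eqxx => /(_ isT isT).
have szP : (1 < size P)%N.
  rewrite ltnNge; apply/negP => /size1_polyC Pc; move: P0.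
  rewrite Pc polyC_eq0 => /eqP; apply; apply: (poly_eq0_inj_roots zk_inj) => k.
  by have [w] := sing _ (zk1 k); rewrite {1}Pc evC.
have szQ : (1 < size Q)%N.
  have [zs [szz QE PE]] := slices_normal no_zero ator (zk1 0).
  have := size_poly (size Q) (fun i => (Q`_i).[zk 0]).
  rewrite -/(slice (zk 0%N) Q).
  have -> : size (\poly_(i < size Q) (Q`_i).[zk 0%N]) = m.+2.
    by rewrite -[\poly_(i < _) _]/(slice (zk 0%N) Q) QE size_scale ?size_prod_XsubC ?szz // lead_Q_neq0.
  by apply: leq_trans.
have Q0 : Q != 0 by rewrite -size_poly_gt0 (ltn_trans _ szQ).
have res0 : resultant P Q = 0.
  have [[x y] /= [_ _ xyE]] := resultant_in_ideal szP szQ.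
  apply: (poly_eq0_inj_roots zk_inj) => k.
  have [w Pw Qw] := sing _ (zk1 k).
  by rewrite -(evC _ w) xyE evD !evM Pw Qw !mulr0 addr0.
have [U [V1 [V2 [PE QE [z1 [z2 [w1 [w2 []]]]]]]]] := common_factor P0 Q0 res0.
exact: ator PE QE _ _ _ _.
Qed.

(** At [z] the quotient [u / v] is the sum treated in [cabs_contact_sum], where [e] is the distance
    from the circle to the outermost zero [w0]. *)
Lemma contact_estimate z : cabs z = 1 -> v.[z] != 0 ->
  (forall w, cabs w = 1 -> ev z w P != 0) /\
  exists w0, [/\ ev z w0 Q = 0, forall w, ev z w Q = 0 -> cabs w <= cabs w0, cabs w0 < 1,
    cabs v.[z] / 2 <= (1 - cabs w0) * cabs u.[z] &
    (1 - cabs w0) * cabs u.[z] <= (m.+1 * m.+1)%:R * cabs v.[z]].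
Proof.
move=> z1 vz; have [zs [szz QE PE]] := slices_normal no_zero ator z1.
have := vz; rewrite (contact_den_neq0 z1 szz QE PE) => /allP lt1.
have rz := slices_normal_roots z1 QE.
split=> [w w1|].
  by rewrite -Q_eq0_circle // rz; apply/negP => /lt1; rewrite w1 ltxx.
have [|w0 w0s w0max] := @seq_max_cabs _ zs; first by rewrite szz.
have w01 := lt1 _ w0s.
have bw1 b w : b \in [seq w^* | w <- zs] -> w \in zs -> b * w != 1.
  case/mapP => y ys -> ws; apply/negP => /eqP/(congr1 (@cabs R)).
  rewrite cabs1 cabsM cabsJ; have := lt1 w ws; have := lt1 y ys.
  have := cabs_ge0 w; have := cabs_ge0 y; nra.
have w0pos : 0 < 1 - cabs w0 by lra.
have := @cabs_contact_sum _ zs (1 - cabs w0) w0 w0s w0pos erefl; rewrite szz => sumP.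
have /sumP/andP[lo hi] : forall z, z \in zs -> 1 - cabs w0 <= 1 - cabs z.
  by move=> w /w0max; lra.
have uE := horner_contact_num (lead_Q_neq0 no_zero ator z1) szz (etrans (size_map _ _) szz) QE PE bw1.
have vpos : 0 < cabs v.[z] by rewrite cabs_gt0.
exists w0; split=> //; first by apply/eqP; rewrite rz.
- by move=> w /eqP; rewrite rz; apply: w0max.
- rewrite /u uE cabsM mulrCA ler_pM2l //; lra.
- by rewrite /u uE cabsM mulrCA mulrC ler_pM2r.
Qed.

End Contact.

Lemma contact_function (R : rcfType) (m n : nat) (a : nat -> nat -> R[i]) :
  let P := pol m n a in let Q := pol m n (refl m n a) in (0 < m)%N ->
  (forall z1 z2, cabs z1 < 1 -> cabs z2 < 1 -> ev z2 z1 P != 0) ->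
  (forall U V1 V2, P = U * V1 -> Q = U * V2 ->
    forall z1 z2 w1 w2, ev z2 z1 U = ev w2 w1 U) ->
  exists (u v : {poly R[i]}) (B : R), [/\ v != 0, 0 < B & forall z, cabs z = 1 -> v.[z] != 0 ->
    (forall w, cabs w = 1 -> ev z w P != 0) /\
    exists w0, [/\ ev z w0 Q = 0, forall w, ev z w Q = 0 -> cabs w <= cabs w0, cabs w0 < 1,
      cabs v.[z] / 2 <= (1 - cabs w0) * cabs u.[z] &
      (1 - cabs w0) * cabs u.[z] <= B * cabs v.[z]]].
Proof.
case: m => // m P Q _ no_zero ator.
exists (contact_num m Q P), (contact_den m Q P), (m.+1 * m.+1)%:R; split.
- exact: contact_den_nonzero no_zero ator.
- by rewrite ltr0n.
- by move=> z z1 vz; apply: contact_estimate.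
Qed.

(** * Passing to the half plane *)

Section Chart.
Variable R : rcfType.
Local Notation C := R[i].
Variables (m n : nat) (a : nat -> nat -> C) (t1 t2 c0 : C).

(* [p(t1 beta(w1), t2 beta(w2))] without its denominators; [c0] is a constant that
   makes the sum with the reflected polynomial real. *)
Definition halfplane_poly (w1 w2 : C) : C :=
  \sum_(i < m.+1) \sum_(j < n.+1) c0 * a i j * t1 ^+ i * t2 ^+ j *
    ((1 + 'i * w1) ^+ i * (1 - 'i * w1) ^+ (m - i) *
     ((1 + 'i * w2) ^+ j * (1 - 'i * w2) ^+ (n - j))).

Definition const2 (c : C) : {poly {poly C}} := c%:P%:P.
Definition cayley_num (w : {poly {poly C}}) : {poly {poly C}} := 1 + const2 'i * w.
Definition cayley_den (w : {poly {poly C}}) : {poly {poly C}} := 1 - const2 'i * w.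
(** The inner indeterminate is [l] and the outer one is [x]. *)
Definition chart_w1 : {poly {poly C}} := polyC 'X * 'X.

Definition chart : {poly {poly C}} :=
  \sum_(i < m.+1) \sum_(j < n.+1) const2 (c0 * a i j * t1 ^+ i * t2 ^+ j) *
    (cayley_num chart_w1 ^+ i * cayley_den chart_w1 ^+ (m - i) *
     (cayley_num 'X ^+ j * cayley_den 'X ^+ (n - j))).

Lemma ev1 l x : ev l x (1 : {poly {poly C}}) = 1.
Proof. exact: (rmorph1 (evm l x)). Qed.
Lemma ev_const2 l x c : ev l x (const2 c) = c.
Proof. by rewrite /const2 evC hornerC. Qed.
Lemma ev_cayley_num l x w : ev l x (cayley_num w) = 1 + 'i * ev l x w.
Proof. by rewrite /cayley_num evD ev1 evM ev_const2. Qed.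
Lemma ev_cayley_den l x w : ev l x (cayley_den w) = 1 - 'i * ev l x w.
Proof. by rewrite /cayley_den evD ev1 evN evM ev_const2. Qed.
Lemma ev_chart_w1 l x : ev l x chart_w1 = l * x.
Proof. by rewrite /chart_w1 evM evC hornerX evX. Qed.

Lemma ev_chart l x : ev l x chart = halfplane_poly (l * x) x.
Proof.
rewrite /chart ev_sum; apply: eq_bigr => i _; rewrite ev_sum; apply: eq_bigr => j _.
rewrite evM ev_const2 evM !evM !evXn !(ev_cayley_num, ev_cayley_den).
by rewrite ev_chart_w1 evX.
Qed.

Lemma halfplane_polyE w1 w2 : 1 - 'i * w1 != 0 -> 1 - 'i * w2 != 0 ->
  halfplane_poly w1 w2 = c0 * (1 - 'i * w1) ^+ m * (1 - 'i * w2) ^+ n *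
    ev (t2 * beta w2) (t1 * beta w1) (pol m n a).
Proof.
move=> d1 d2; rewrite ev_pol mulr_sumr; apply: eq_bigr => i _.
rewrite mulr_sumr; apply: eq_bigr => j _.
have im : (i <= m)%N by rewrite -ltnS.
have jn : (j <= n)%N by rewrite -ltnS.
rewrite /beta !exprMn !exprVn.
have <- : (1 - 'i * w1) ^+ (m - i) * (1 - 'i * w1) ^+ i = (1 - 'i * w1) ^+ m.
  by rewrite -exprD subnK.
have <- : (1 - 'i * w2) ^+ (n - j) * (1 - 'i * w2) ^+ j = (1 - 'i * w2) ^+ n.
  by rewrite -exprD subnK.
have e1 := expf_neq0 i d1; have e2 := expf_neq0 j d2.
by field; rewrite e1 e2.
Qed.

Hypothesis t1_unit : cabs t1 = 1.
Hypothesis t2_unit : cabs t2 = 1.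
Hypothesis c0_conj : c0^* = c0 * t1 ^+ m * t2 ^+ n.

(** Conjugation exchanges [1 + 'i w] and [1 - 'i w], which reverses the indices and turns [a] into
    its reflection. The condition on [c0] yields the same prefactor as in [halfplane_polyE], so sum
    and difference are multiples of [P + Q] and [P - Q]. *)
Lemma halfplane_poly_conj w1 w2 : 1 - 'i * w1 != 0 -> 1 - 'i * w2 != 0 ->
  (halfplane_poly w1^* w2^*)^* = c0 * (1 - 'i * w1) ^+ m * (1 - 'i * w2) ^+ n *
    ev (t2 * beta w2) (t1 * beta w1) (pol m n (refl m n a)).
Proof.
move=> d1 d2; rewrite ev_pol mulr_sumr rmorph_sum /=.
rewrite (reindex_inj rev_ord_inj) /=; apply: eq_bigr => i _.
rewrite mulr_sumr rmorph_sum /= (reindex_inj rev_ord_inj) /=; apply: eq_bigr => j _.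
have im : (i <= m)%N by rewrite -ltnS.
have jn : (j <= n)%N by rewrite -ltnS.
have u1 (w : C) : (1 + 'i * w^*)^* = 1 - 'i * w.
  by case: w => p q; apply/eqP; rewrite eq_complex /=; apply/andP; split; apply/eqP; ring.
have u2 (w : C) : (1 - 'i * w^*)^* = 1 + 'i * w.
  by case: w => p q; apply/eqP; rewrite eq_complex /=; apply/andP; split; apply/eqP; ring.
rewrite !subSS !subKn // !(rmorphM, rmorphXn) /= !(u1, u2) /refl c0_conj.
rewrite (conj_unit t1_unit) (conj_unit t2_unit) /beta !exprMn !exprVn.
have t10 : t1 != 0 by rewrite -cabs_gt0 t1_unit.
have t20 : t2 != 0 by rewrite -cabs_gt0 t2_unit.
have <- : t1 ^+ (m - i) * t1 ^+ i = t1 ^+ m by rewrite -exprD subnK.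
have <- : t2 ^+ (n - j) * t2 ^+ j = t2 ^+ n by rewrite -exprD subnK.
have <- : (1 - 'i * w1) ^+ (m - i) * (1 - 'i * w1) ^+ i = (1 - 'i * w1) ^+ m.
  by rewrite -exprD subnK.
have <- : (1 - 'i * w2) ^+ (n - j) * (1 - 'i * w2) ^+ j = (1 - 'i * w2) ^+ n.
  by rewrite -exprD subnK.
have e1 := expf_neq0 i d1; have e2 := expf_neq0 j d2.
have e3 := expf_neq0 (m - i) t10; have e4 := expf_neq0 (n - j) t20.
by field; rewrite e1 e2 e3 e4.
Qed.

End Chart.

(** Otherwise division by [r ^ b] leaves [A <= B r] for arbitrarily small [r]. *)
Lemma exponent_le (R : rcfType) (A B : R) (b k : nat) : 0 < A ->
  (forall e : R, 0 < e -> exists2 r, 0 < r < e & A * r ^+ b <= B * r ^+ k) -> (k <= b)%N.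
Proof.
move=> A0 small; rewrite leqNgt; apply/negP => bk.
have B0 : 0 < B.
  have [//|r /andP[r0 _] le1] := small 1.
  have := lt_le_trans (mulr_gt0 A0 (exprn_gt0 b r0)) le1.
  by rewrite pmulr_lgt0 // exprn_gt0.
have [|r /andP[r0 re] le1] := small (Num.min 1 (A / B)).
  by rewrite lt_min ltr01 divr_gt0.
move: re; rewrite lt_min ltr_pdivlMr // => /andP[r1 rAB].
move: le1; rewrite -(subnK bk) addnS -addSn exprD mulrA ler_pM2r ?exprn_gt0 // exprS.
have : r ^+ (k - b.+1) <= 1 by rewrite exprn_ile1 // ltW.
set y := r ^+ _ => y1 le1.
have : B * (r * y) <= B * (r * 1) by rewrite (ler_wpM2l (ltW B0)) // ler_wpM2l // ltW.
lra.
Qed.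

Section BetaMore.
Variable R : rcfType.
Local Notation C := R[i].

Lemma cabs_beta_sub1 (x : R) : 0 < x <= 1 ->
  x <= cabs (beta x%:C - 1) <= 2 * x.
Proof.
move=> /andP[x0 x1]; have d0 := real_den_neq0 x.
have -> : beta x%:C - 1 = 2 * 'i * x%:C / (1 - 'i * x%:C).
  by rewrite /beta; field.
have cd0 : 0 < cabs (1 - 'i * x%:C) by rewrite cabs_gt0.
rewrite !cabsM cabsV cabs_i mulr1 cabs_real gtr0_norm //.
have -> : cabs (2 : C) = 2 by rewrite -[2 in LHS](rmorph_nat (real_complex R)) cabs_real normr_nat.
have c2 : cabs (1 - 'i * x%:C) ^+ 2 = 1 + x ^+ 2 by rewrite cabs_sqr /=; ring.
have [c1 c3] : 1 <= cabs (1 - 'i * x%:C) /\ cabs (1 - 'i * x%:C) <= 2.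
  by split; rewrite -(ler_pXn2r (ltn0Sn 1)) ?nnegrE ?cabs_ge0 // c2; nra.
by rewrite ler_pdivlMr // ler_pdivrMr //; apply/andP; split; nra.
Qed.

Lemma beta_onto (y : C) : y != -1 -> exists2 w, 1 - 'i * w != 0 & beta w = y.
Proof.
move=> y1; have y0 : y + 1 != 0 by rewrite addr_eq0.
have ii : 'i * 'i = -1 :> C by rewrite -expr2 sqr_i.
have e : 'i * (- 'i * (y - 1) / (y + 1)) = (y - 1) / (y + 1) :> C.
  by rewrite !mulrA mulrN ii opprK mul1r.
exists (- 'i * (y - 1) / (y + 1)).
  have -> : 1 - 'i * (- 'i * (y - 1) / (y + 1)) = 2 / (y + 1) by rewrite e; field.
  by rewrite mulf_neq0 ?invr_eq0 // pnatr_eq0.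
rewrite /beta e; field; rewrite y0 /=.
have -> : y + 1 - (y - 1) = 2 by ring.
by rewrite pnatr_eq0.
Qed.

(** Writing [v = Im w] and [A = |1 + 'i w|^2], one has [|1 - 'i w|^2 = A + 4 v], so the hypothesis
    gives [4 v <= - e A]. Then [v <= 0], which implies [A >= 1]. *)
Lemma Im_of_beta_ge (w : C) (e : R) : 0 < e <= 1 -> 
  cabs (1 - 'i * w) <= (1 - e) * cabs (1 + 'i * w) -> Im w <= - (e / 4).
Proof.
move=> /andP[e0 e1] h.
have : cabs (1 - 'i * w) ^+ 2 <= ((1 - e) * cabs (1 + 'i * w)) ^+ 2.
  by rewrite lerXn2r ?nnegrE ?cabs_ge0 // mulr_ge0 ?cabs_ge0 //; lra.
rewrite exprMn !cabs_sqr; case: w {h} => u v /=.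
rewrite !(mul0r, mul1r, sub0r, add0r, opprK, addr0, oppr0).
set A := (1 + - v) ^+ 2 + u ^+ 2.
have -> : (1 + v) ^+ 2 + (- u) ^+ 2 = A + 4 * v by rewrite /A; ring.
have A0 : 0 <= A by rewrite addr_ge0 ?sqr_ge0.
move=> h1.
have h2 : (1 - e) ^+ 2 * A <= (1 - e) * A by rewrite ler_wpM2r // expr2; nra.
have h3 : 4 * v <= - (e * A) by lra.
have v0 : v <= 0 by have := mulr_ge0 (ltW e0) A0; lra.
have A1 : 1 <= A by rewrite /A; have := sqr_ge0 u; nra.
have : e <= e * A by rewrite ler_peMr // ltW.
lra.
Qed.

End BetaMore.

(** * The exponent when the lowest term depends on the slope *)

Section Core.
Variable R : rcfType.
Local Notation C := R[i].
Variables (m n : nat) (a : nat -> nat -> C) (t1 t2 c0 : C).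
Let P := pol m n a.
Let Q := pol m n (refl m n a).
Hypothesis no_zero : forall z1 z2, cabs z1 < 1 -> cabs z2 < 1 -> ev z2 z1 P != 0.
Hypothesis ator : forall U V1 V2, P = U * V1 -> Q = U * V2 ->
  forall z1 z2 w1 w2, ev z2 z1 U = ev w2 w1 U.
Hypothesis t1_unit : cabs t1 = 1.
Hypothesis t2_unit : cabs t2 = 1.
Hypothesis sing : ev t2 t1 P = 0.
Hypothesis c0_neq0 : c0 != 0.
Hypothesis c0_conj : c0^* = c0 * t1 ^+ m * t2 ^+ n.
Let F := chart m n a t1 t2 c0.
Let Dc := F + conj2 F.
Let Nc := const2 'i * (F - conj2 F).

Lemma m_gt0 : (0 < m)%N.
Proof.
rewrite lt0n; apply/negP => /eqP m0; have := slice_P_neq0 ator t2_unit.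
have /size1_polyC : (size (slice t2 P) <= 1)%N.
  by rewrite (leq_trans (size_poly _ _)) // /P m0 size_poly.
move=> Pc; move: sing; rewrite ev_is_map Pc hornerC => ->.
by rewrite polyC0 eqxx.
Qed.

Let zx (x : R) : C := t2 * beta x%:C.

Lemma cabs_zx x : cabs (zx x) = 1.
Proof. by rewrite cabsM t2_unit cabs_beta_real mulr1. Qed.

Lemma zx_inj : injective (fun k : nat => zx k%:R).
Proof.
have t20 : t2 != 0 by rewrite -cabs_gt0 t2_unit.
by move=> k l /(mulfI t20)/beta_inj_real/eqP; rewrite eqr_nat => /eqP.
Qed.

Lemma ev_Dc (x : R) (w : C) : x != 0 -> 1 - 'i * w != 0 ->
  ev (w / x%:C) x%:C Dc = c0 * (1 - 'i * w) ^+ m * (1 - 'i * x%:C) ^+ n *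
    (ev (zx x) (t1 * beta w) P + ev (zx x) (t1 * beta w) Q).
Proof.
move=> x0 w0; have xc0 : x%:C != 0 by rewrite eq_complex /= eqxx andbT.
have wc : (w / x%:C)^* * x%:C^* = w^* by rewrite -rmorphM divfK.
rewrite evD ev_conj2 !ev_chart wc divfK // mulrDr.
rewrite halfplane_polyE ?halfplane_poly_conj ?real_den_neq0 //.
Qed.

Lemma chart_root_Im (x : R) w0 l : 0 < x ->
  (forall w, cabs w = 1 -> ev (zx x) w P != 0) ->
  (forall w, ev (zx x) w Q = 0 -> cabs w <= cabs w0) -> cabs w0 < 1 ->
  root F.[x%:C%:P] l -> Im l <= - ((1 - cabs w0) / 4 / x).
Proof.
move=> x0 nsing w0max w01; rewrite /root -[_.[_].[_]]/(ev l x%:C F) ev_chart.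
set w := l * x%:C => /eqP Fw.
have e1 : 0 < 1 - cabs w0 <= 1 by have := cabs_ge0 w0; lra.
suff : Im w <= - ((1 - cabs w0) / 4).
  have -> : Im w = Im l * x by rewrite /w; case: (l) => p q /=; ring.
  by move=> h; rewrite -mulNr ler_pdivlMr.
(* At the pole of [beta] the imaginary part is -1, which suffices since [1 - cabs w0 <= 1]. *)
have [d0|d0] := eqVneq (1 - 'i * w) 0.
  have -> : Im w = -1.
    move/(congr1 (@complex.Re R)): d0; case: (w) => p q /=; lra.
  lra.
apply: Im_of_beta_ge => //.
move/eqP: Fw; rewrite halfplane_polyE ?real_den_neq0 // !mulf_eq0.
rewrite !expf_eq0 (negbTE c0_neq0) (negbTE d0) (negbTE (real_den_neq0 x)) !andbF /=.
rewrite -/P -/(zx x); set z := t1 * beta w => /eqP Pz.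
have z1 : 1 <= cabs z.
  rewrite leNgt; apply/negP => z1.
  by have := P_neq0_disk_circle no_zero ator z1 (cabs_zx x); rewrite Pz eqxx.
have z0 : z != 0 by rewrite -cabs_gt0; lra.
have Qz : ev (zx x) (z^*)^-1 Q = 0.
  rewrite ev_refl ?cabs_zx ?invr_eq0 ?conjc_eq0 //.
  by rewrite conjc_inv conjcK invrK -/P Pz rmorph0 mulr0.
have := w0max _ Qz; rewrite cabsV cabsJ /z cabsM t1_unit mul1r /beta cabsM cabsV invf_div.
have n0 : 0 < cabs (1 + 'i * w).
  rewrite cabs_gt0; apply: contraTneq z1 => n0.
  by rewrite /z /beta n0 mul0r mulr0 cabs0 -ltNge.
rewrite ler_pdivrMr //; lra.
Qed.

(** If [Dc] vanished, [P] would vanish with [Q] at the zero [w0] inside the disk wherever [v] is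
    nonzero, against [P_neq0_disk_circle]. So [v] would have infinitely many zeros. *)
Lemma Dc_neq0 : Dc != 0.
Proof.
have [u [v [B [v0 B0 est]]]] := contact_function m_gt0 no_zero ator.
apply: contra_neq v0 => D0; apply: (@poly_eq0_inj_roots _ _ (fun j : nat => zx j.+1%:R)).
  by move=> i j /zx_inj [].
move=> j; set x : R := j.+1%:R; apply/eqP; apply: contraT => vz.
have [_ [w0 [Qw0 _ w01 _ _]]] := est _ (cabs_zx _) vz.
have t10 : t1 != 0 by rewrite -cabs_gt0 t1_unit.
have [|w dw bw] := @beta_onto _ (w0 / t1).
  apply/negP => /eqP/(congr1 (@cabs R)).
  by rewrite cabsM cabsV t1_unit invr1 mulr1 cabsN cabs1; lra.
have xn : x != 0 by rewrite pnatr_eq0.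
have tw : t1 * beta w = w0 by rewrite bw mulrCA mulfV // mulr1.
have := ev_Dc xn dw; rewrite D0 ev_is_map map_poly0 horner0 tw Qw0 addr0 => /esym/eqP.
rewrite !mulf_eq0 !expf_eq0 (negbTE c0_neq0) (negbTE dw) (negbTE (real_den_neq0 x)) !andbF /=.
by rewrite (negbTE (P_neq0_disk_circle no_zero ator w01 (cabs_zx x))).
Qed.

Variables (k : nat) (Pc Dh : {poly {poly C}}) (d : nat).
Hypothesis DcE : Dc = 'X^d * Dh.
Hypothesis Dh0 : (1 < size (Dh`_0)%R)%N.
Hypothesis BJ : forall l : R, 0 < l -> exists e M : R, 0 < e /\ forall s : R, 0 < s < e ->
    ev l%:C ('i * s%:C) Dc != 0 ->
    cabs (ev l%:C ('i * s%:C) (Nc - Pc * Dc)) <=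
    M * s ^+ k * cabs (ev l%:C ('i * s%:C) Dc).

(** The distance [1 - cabs w0] is comparable to [|v| / |u|], so [K] is the difference [b - au] of
    the orders of [v] and [u] at [t2]. [chart_bound] gives the lower bound on [K]. *)
Theorem contact_exponent : exists (K : nat) (c1 c2 e : R),
  [/\ (k.+1 <= K)%N, 0 < c1, 0 < c2, 0 < e & forall z, cabs z = 1 -> 0 < cabs (z - t2) < e ->
    (forall w, cabs w = 1 -> ev z w P != 0) /\
    exists w0, [/\ ev z w0 Q = 0, forall w, ev z w Q = 0 -> cabs w <= cabs w0 &
      c1 * cabs (z - t2) ^+ K <= 1 - cabs w0 <= c2 * cabs (z - t2) ^+ K]].
Proof.
have [u [v [B [v0 B0 est]]]] := contact_function m_gt0 no_zero ator.
have u0 : u != 0.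
  apply: contra_neq v0 => u0; apply: (poly_eq0_inj_roots zx_inj) => j; apply/eqP.
  apply: contraT => vz; have [_ [w0 [_ _ _]]] := est _ (cabs_zx _) vz.
  rewrite u0 horner0 cabs0 mulr0 => h _; move: vz; rewrite -cabs_gt0; lra.
have [b [c1v [c2v [ev' [c1v0 c2v0 ev0' vord]]]]] := poly_local_order t2 v0.
have [au [c1u [c2u [eu [c1u0 c2u0 eu0 uord]]]]] := poly_local_order t2 u0.
pose e := Num.min ev' eu; have e0 : 0 < e by rewrite lt_min ev0'.
have good z : 0 < cabs (z - t2) < e ->
  [/\ v.[z] != 0, c1v * cabs (z - t2) ^+ b <= cabs v.[z] <= c2v * cabs (z - t2) ^+ b &
    c1u * cabs (z - t2) ^+ au <= cabs u.[z] <= c2u * cabs (z - t2) ^+ au].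
  move=> /andP[r0]; rewrite lt_min => /andP[rv ru]; split; [|exact: vord|exact: uord].
  rewrite -cabs_gt0; have /andP[h _] := vord z rv; apply: lt_le_trans h.
  by rewrite mulr_gt0 // exprn_gt0.
have zr (x : R) : 0 < x <= 1 -> x <= cabs (zx x - t2) <= 2 * x.
  move=> xx; have -> : zx x - t2 = t2 * (beta x%:C - 1) by rewrite /zx; ring.
  by rewrite cabsM t2_unit mul1r cabs_beta_sub1.
pose x0 := Num.min 1 (e / 2).
have x00 : 0 < x0 by rewrite lt_min ltr01 divr_gt0.
have zgood (x : R) : 0 < x < x0 -> 0 < cabs (zx x - t2) < e /\ x <= cabs (zx x - t2) <= 2 * x.
  move=> /andP[xp]; rewrite lt_min => /andP[x1 xe].
  have xx : 0 < x <= 1 by rewrite xp ltW.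
  have := zr x xx; lra.
clearbody x0.
have [Rh HE] : exists Rh, Nc - Pc * Dc = 'X^(k + d) * Rh.
  apply: order_transfer DcE _ BJ; by rewrite -size_poly_gt0 (ltn_trans _ Dh0).
have rootsF (x : R) : 0 < x < x0 -> exists2 h, 0 < h &
    forall l, root F.[x%:C%:P] l -> Im l <= - h.
  move=> xx; have [/good[vz _ _] _] := zgood x xx; have xp : 0 < x by case/andP: xx.
  have [ns [w0 [_ w0max w01 _ _]]] := est _ (cabs_zx _) vz.
  exists ((1 - cabs w0) / 4 / x); first by apply: divr_gt0 => //; lra.
  by move=> l; apply: chart_root_Im.
have [M [e1 [e10 bound]]] := chart_bound DcE Dh0 HE x00 rootsF.
(* [chart_bound] with [h = (1 - cabs w0) / (4 x)] makes [1 - cabs w0] of order [x ^ k.+1], the extra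
   factor coming from the blow-up. Comparison with [|v| / |u|] along small [x > 0] bounds the
   orders. *)
have kb : (k.+1 + au <= b)%N.
  apply: (@exponent_le _ (c1v / 2) (4 * `|M| * c2u)); first by rewrite divr_gt0.
  move=> e' e'0; pose x := Num.min (Num.min x0 e1) (e' / 2) / 2.
  have mp : 0 < Num.min (Num.min x0 e1) (e' / 2) by rewrite !lt_min x00 e10 divr_gt0.
  have [h1 h2 h3] : [/\ 2 * x <= x0, 2 * x <= e1 & 2 * x <= e' / 2].
    by rewrite /x mulrC divfK ?pnatr_eq0 // !ge_min !lexx !orbT.
  have xp : 0 < x by rewrite divr_gt0.
  have xx : 0 < x < x0 by lra.
  have xe1 : 0 < x < e1 by lra.
  have [rr xr] := zgood x xx; exists (cabs (zx x - t2)); first lra.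
  have [vz /andP[vlo _] /andP[_ uhi]] := good _ rr.
  have [ns [w0 [_ w0max w01 est1 _]]] := est _ (cabs_zx _) vz.
  have hp : 0 < (1 - cabs w0) / 4 / x by apply: divr_gt0 => //; lra.
  have := bound x _ xe1 hp (fun l => chart_root_Im xp ns w0max w01 (l := l)).
  rewrite ler_pdivrMr // -[M * _ * x]mulrA -exprSr => le1.
  set r := cabs (zx x - t2) in rr xr vlo uhi *.
  have le2 : 1 - cabs w0 <= 4 * `|M| * r ^+ k.+1.
    have : M * x ^+ k.+1 <= `|M| * r ^+ k.+1.
      apply: le_trans (_ : `|M| * x ^+ k.+1 <= _).
        by rewrite ler_wpM2r ?ler_norm // exprn_ge0 // ltW.
      by rewrite ler_wpM2l ?normr_ge0 // lerXn2r ?nnegrE //; lra.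
    lra.
  have le3 : (1 - cabs w0) * cabs u.[zx x] <= 4 * `|M| * r ^+ k.+1 * (c2u * r ^+ au).
    by apply: ler_pM => //; rewrite ?cabs_ge0 //; lra.
  rewrite exprD; lra.
pose K := (b - au)%N.
have bE : b = (K + au)%N by rewrite subnK // (leq_trans (leq_addl _ _) kb).
exists K, (c1v / 2 / c2u), (B * c2v / c1u), e; split=> //.
- by rewrite leq_subRL ?(leq_trans (leq_addl _ _) kb) // addnC.
- by rewrite !divr_gt0.
- by rewrite divr_gt0 // mulr_gt0.
move=> z z1 zz; have [vz /andP[vlo vhi] /andP[ulo uhi]] := good z zz.
have [ns [w0 [Qw0 w0max w01 est1 est2]]] := est _ z1 vz; split=> //.
exists w0; split=> //.
set r := cabs (z - t2) in zz vlo vhi ulo uhi *; have r0 : 0 < r by case/andP: zz.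
have ra : 0 < r ^+ au by rewrite exprn_gt0.
rewrite bE exprD in vlo vhi.
set y := r ^+ K in vlo vhi *; set s := r ^+ au in ra vlo vhi ulo uhi *.
set t := 1 - cabs w0 in est1 est2 *; have t0 : 0 < t by rewrite /t; lra.
apply/andP; split.
  rewrite mulrAC ler_pdivrMr // -(ler_pM2r ra).
  have : t * cabs u.[z] <= t * (c2u * s) by rewrite ler_wpM2l // ltW.
  lra.
rewrite mulrAC ler_pdivlMr // -(ler_pM2r ra).
have : t * (c1u * s) <= t * cabs u.[z] by rewrite ler_wpM2l // ltW.
have : B * cabs v.[z] <= B * (c2v * (y * s)) by rewrite ler_wpM2l // ltW.
lra.
Qed.

End Core.

(** * Transfer from the definitions over pairs of reals *)

Section Bridge.
Local Notation RR := Rdefinitions.R.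
Local Notation C := (complex RR).

Definition toC (z : Cx) : C := Complex (fst z) (snd z).
Definition ofC (z : C) : Cx := (Re z, Im z).

Lemma toCK : cancel toC ofC. Proof. by case. Qed.
Lemma ofCK : cancel ofC toC. Proof. by case. Qed.
Lemma toC_inj : injective toC. Proof. exact: can_inj toCK. Qed.
Lemma toCD z w : toC (Cadd z w) = toC z + toC w. Proof. by []. Qed.
Lemma toCB z w : toC (Csub z w) = toC z - toC w. Proof. by []. Qed.
Lemma toCM z w : toC (Cmul z w) = toC z * toC w. Proof. by []. Qed.
Lemma toC1 : toC Defs.C1 = 1. Proof. by []. Qed.
Lemma toCi : toC Ci = 'i. Proof. by []. Qed.
Lemma toCR (x : RR) : toC (RtoC x) = x%:C. Proof. by []. Qed.
Lemma toCV z : toC (Cinv z) = (toC z)^-1.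
Proof.
case: z => x y; rewrite /toC /Cinv !RdivE !RpowE.
by apply/eqP; rewrite eq_complex /= mulNr !eqxx.
Qed.
Lemma toC_div z w : toC (Cdiv z w) = toC z / toC w.
Proof. by rewrite /Cdiv toCM toCV. Qed.
Lemma toCX z k : toC (Cpow z k) = toC z ^+ k.
Proof. by elim: k => [|k IHk]; rewrite ?expr0 // exprS -IHk. Qed.
Lemma toC_abs z : Cabs z = cabs (toC z).
Proof. by rewrite /Cabs /cabs RsqrtE !RpowE. Qed.
Lemma toC_csum f k : toC (csum f k) = \sum_(i < k) toC (f i).
Proof. by elim: k => [|k IHk]; rewrite ?big_ord0 // big_ord_recr /= -IHk. Qed.

Definition toCa (a : nat -> nat -> Cx) i j : C := toC (a i j).

Lemma toC_peval m n a z1 z2 :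
  toC (peval m n a z1 z2) = ev (toC z2) (toC z1) (pol m n (toCa a)).
Proof.
rewrite ev_pol toC_csum; apply: eq_bigr => i _; rewrite toC_csum; apply: eq_bigr => j _.
by rewrite !toCM !toCX.
Qed.

Lemma toC_ptilde m n a z1 z2 :
  toC (ptilde m n a z1 z2) = ev (toC z2) (toC z1) (pol m n (refl m n (toCa a))).
Proof. exact: toC_peval. Qed.

Lemma toC_beta w : toC (beta_t w) = beta (toC w).
Proof. by rewrite /beta_t toC_div. Qed.

Lemma pol_coef (U : {poly {poly C}}) :
  pol (size U) (\max_(i < size U) size (U`_i)%R) (fun i j => U`_i`_j) = U.
Proof.
have szU i : (size (U`_i)%R <= \max_(i < size U) size (U`_i)%R)%N.
  have [iU|iU] := ltnP i (size U); last by rewrite [U`_i]nth_default // size_poly0.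
  exact: (@leq_bigmax _ (fun i : 'I_(size U) => size (U`_i)%R) (Ordinal iU)).
apply/polyP => i; rewrite coef_poly; case: ltnP => [_|iU]; last first.
  by rewrite [RHS]nth_default // ltnW.
apply/polyP => j; rewrite coef_poly; case: ltnP => // jU.
by rewrite [RHS]nth_default // (leq_trans (szU i)) // ltnW.
Qed.

Lemma isPoly_ev (U : {poly {poly C}}) :
  IsPoly (fun z1 z2 => ofC (ev (toC z2) (toC z1) U)).
Proof.
exists (size U), (\max_(i < size U) size (U`_i)%R)%N, (fun i j => ofC U`_i`_j).
move=> z1 z2; apply: toC_inj; rewrite ofCK toC_peval -{1}(pol_coef U).
by rewrite !ev_pol; apply: eq_bigr => i _; apply: eq_bigr => j _; rewrite /toCa ofCK.
Qed.

Lemma no_zeros_ev m n a : no_zeros_in_bidisk m n a ->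
  forall z1 z2, cabs z1 < 1 -> cabs z2 < 1 -> ev z2 z1 (pol m n (toCa a)) != 0.
Proof.
move=> nz z1 z2 z11 z21; have := nz (ofC z1) (ofC z2).
rewrite !toC_abs !ofCK => /(_ (elimT RltP z11) (elimT RltP z21)) nz0.
apply/negP => /eqP Pz; apply: nz0; apply: toC_inj.
by rewrite toC_peval !ofCK Pz.
Qed.

Lemma atoral_ev m n a : atoral m n a ->
  forall U V1 V2, pol m n (toCa a) = U * V1 -> pol m n (refl m n (toCa a)) = U * V2 ->
  forall z1 z2 w1 w2, ev z2 z1 U = ev w2 w1 U.
Proof.
move=> ator U V1 V2 PE QE z1 z2 w1 w2; apply/eqP; apply: contraT => /eqP neq.
case: (ator (fun x1 x2 => ofC (ev (toC x2) (toC x1) U))).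
- exact: isPoly_ev.
- exists (ofC z1), (ofC z2), (ofC w1), (ofC w2); rewrite !ofCK.
  by move/(congr1 toC); rewrite !ofCK.
- exists (fun x1 x2 => ofC (ev (toC x2) (toC x1) V1)); split; first exact: isPoly_ev.
  by move=> x1 x2; apply: toC_inj; rewrite toC_peval toCM !ofCK PE evM.
- exists (fun x1 x2 => ofC (ev (toC x2) (toC x1) V2)); split; first exact: isPoly_ev.
  by move=> x1 x2; apply: toC_inj; rewrite toC_ptilde toCM !ofCK QE evM.
Qed.

Definition transpose (A : Type) (a : nat -> nat -> A) i j := a j i.

Lemma peval_trans m n a z1 z2 : peval n m (transpose a) z2 z1 = peval m n a z1 z2.
Proof.
apply: toC_inj; rewrite !toC_peval !ev_pol exchange_big; apply: eq_bigr => i _.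
by apply: eq_bigr => j _; rewrite [X in _ * X]mulrC.
Qed.

Lemma ptilde_trans m n a z1 z2 : ptilde n m (transpose a) z2 z1 = ptilde m n a z1 z2.
Proof. exact: (peval_trans m n (refl_coef m n a)). Qed.

Lemma phi_trans m n a z1 z2 : phi n m (transpose a) z2 z1 = phi m n a z1 z2.
Proof. by rewrite /phi ptilde_trans peval_trans. Qed.

Lemma g_tau_trans m n a t1 t2 w1 w2 :
  g_tau n m (transpose a) t2 t1 w2 w1 = g_tau m n a t1 t2 w1 w2.
Proof. by rewrite /g_tau phi_trans. Qed.

Lemma taylor_poly_trans N rho w1 w2 :
  taylor_poly N (transpose rho) w2 w1 = taylor_poly N rho w1 w2.
Proof.
apply: toC_inj; rewrite /taylor_poly !toC_csum.
(* Written over the square with the condition [i + j <= N], the triangular sum is visibly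
   symmetric. *)
have tri (f : nat -> nat -> C) :
    \sum_(i < N.+1) \sum_(j < (N - i).+1) f i j =
    \sum_(i < N.+1) \sum_(j < N.+1 | (i + j <= N)%N) f i j.
  apply: eq_bigr => i _; rewrite (big_ord_widen_cond N.+1 xpredT) ?ltnS ?leq_subr //.
  by apply: eq_bigl => j; rewrite ltnS leq_subRL // -ltnS.
under eq_bigr => i _ do rewrite toC_csum.
under [RHS]eq_bigr => i _ do rewrite toC_csum.
rewrite (tri (fun i j => toC (Cmul (RtoC (transpose rho i j)) (Cmul (Cpow w2 i) (Cpow w1 j))))).
rewrite (tri (fun i j => toC (Cmul (RtoC (rho i j)) (Cmul (Cpow w1 i) (Cpow w2 j))))).
rewrite (exchange_big_dep xpredT) //=; apply: eq_bigr => i _.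
apply: eq_big => [j|j _]; first by rewrite addnC.
by rewrite !toCM [X in _ * X]mulrC.
Qed.

Lemma norm2C w1 w2 : norm2 w1 w2 = norm2 w2 w1.
Proof. by rewrite /norm2 Rplus_comm. Qed.

Lemma no_zeros_trans m n a : no_zeros_in_bidisk m n a -> no_zeros_in_bidisk n m (transpose a).
Proof. by move=> nz z1 z2 h1 h2; rewrite peval_trans; apply: nz. Qed.

Lemma IsPoly_swap f : IsPoly f -> IsPoly (fun z1 z2 => f z2 z1).
Proof.
move=> [d1 [d2 [c fE]]]; exists d2, d1, (transpose c) => z1 z2.
by rewrite fE (peval_trans d1 d2 c z2 z1).
Qed.

Lemma atoral_trans m n a : atoral m n a -> atoral n m (transpose a).
Proof.
move=> ator q qP [z1 [z2 [w1 [w2 neq]]]] [r [rP rE]] [s [sP sE]].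
apply: (ator (fun z1 z2 => q z2 z1)); first exact: IsPoly_swap.
- by exists z2, z1, w2, w1.
- exists (fun z1 z2 => r z2 z1); split; first exact: IsPoly_swap.
  by move=> x1 x2; rewrite -rE peval_trans.
- exists (fun z1 z2 => s z2 z1); split; first exact: IsPoly_swap.
  by move=> x1 x2; rewrite -sE ptilde_trans.
Qed.

Lemma singularity_trans m n a t1 t2 :
  is_singularity m n a t1 t2 <-> is_singularity n m (transpose a) t2 t1.
Proof. by rewrite /is_singularity peval_trans; tauto. Qed.

Lemma BJ_trans J m n a t1 t2 :
  is_BJ_point J m n a t1 t2 -> is_BJ_point J n m (transpose a) t2 t1.
Proof.
move=> [lim0 [rho rhoP]]; split.
  move=> e /lim0[de [de0 h]]; exists de; split=> // s sd.
  by rewrite g_tau_trans; apply: h.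
exists (transpose rho) => c /rhoP[de [M [de0 h]]]; exists de, M; split=> // w1 w2 h1 h2.
rewrite norm2C (norm2C (Cinv _)) Rmin_comm g_tau_trans taylor_poly_trans => h3 h4.
exact: h.
Qed.

Lemma local_exponent_trans m n a t K :
  local_exponent (Defs.eps1 n m (transpose a)) t K -> local_exponent (Defs.eps2 m n a) t K.
Proof.
move=> [K0 [c [Cc [de [c0 [Cc0 [de0 h]]]]]]]; split=> //.
exists c, Cc, de; do 3!split=> //.
move=> z z1 /h - /(_ z1)[e [ep eb]]; exists e; split=> //.
have st : sing_z2_coord n m (transpose a) z <-> sing_z1_coord m n a z.
  by split=> -[t' ht]; exists t'; apply/singularity_trans.
case: ep => [[s e0]|[s [[w [Qw ew]] emin]]]; [left|right].
  by split=> //; apply/st.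
split; first by move/st.
split; first by exists w; rewrite -ptilde_trans.
by move=> w'; rewrite -ptilde_trans; apply: emin.
Qed.


Lemma ev_chart_conj2 m n (a : nat -> nat -> C) t1 t2 c0 l x :
  cabs t1 = 1 -> cabs t2 = 1 -> c0^* = c0 * t1 ^+ m * t2 ^+ n ->
  1 - 'i * (l * x) != 0 -> 1 - 'i * x != 0 ->
  let A := c0 * (1 - 'i * (l * x)) ^+ m * (1 - 'i * x) ^+ n in
  let z1 := t1 * beta (l * x) in let z2 := t2 * beta x in
  ev l x (chart m n a t1 t2 c0) = A * ev z2 z1 (pol m n a) /\
  ev l x (conj2 (chart m n a t1 t2 c0)) = A * ev z2 z1 (pol m n (refl m n a)).
Proof.
move=> t11 t21 c0E d1 d2 A z1 z2; rewrite ev_conj2 !ev_chart -rmorphM.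
by rewrite halfplane_polyE // halfplane_poly_conj.
Qed.

Definition taylor_chart N (rho : nat -> nat -> RR) : {poly {poly C}} :=
  \sum_(i < N.+1) \sum_(j < (N - i).+1)
    const2 (rho i j)%:C * (chart_w1 RR ^+ i * 'X ^+ j).

Lemma ev_taylor_chart N rho l x w1 w2 : toC w1 = l * x -> toC w2 = x ->
  ev l x (taylor_chart N rho) = toC (taylor_poly N rho w1 w2).
Proof.
move=> w1E w2E; rewrite /taylor_chart /taylor_poly toC_csum ev_sum.
apply: eq_bigr => i _; rewrite toC_csum ev_sum; apply: eq_bigr => j _.
by rewrite !toCM !toCX toCR w1E w2E !evM !evXn ev_const2 ev_chart_w1 evX.
Qed.

Section CoreBridge.
Variables (m n : nat) (a : nat -> nat -> Cx) (t1 t2 : Cx) (J : nat) (c0 : C).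
Hypothesis nz : no_zeros_in_bidisk m n a.
Hypothesis t1_unit : cabs (toC t1) = 1.
Hypothesis t2_unit : cabs (toC t2) = 1.
Hypothesis c0_neq0 : c0 != 0.
Hypothesis c0_conj : c0^* = c0 * toC t1 ^+ m * toC t2 ^+ n.
Hypothesis BJ : is_BJ_point J m n a t1 t2.
Let F := chart m n (toCa a) (toC t1) (toC t2) c0.
Let Dc := F + conj2 F.
Let Nc := const2 'i * (F - conj2 F).

Lemma imag_den (y : RR) : 0 < y -> 1 - 'i * (Complex 0 y : C) = (1 + y)%:C.
Proof.
by move=> y0; apply/eqP; rewrite eq_complex /=; apply/andP; split; apply/eqP; ring.
Qed.

Lemma imag_beta (y : RR) : 0 < y -> cabs (beta (Complex 0 y : C)) < 1.
Proof.
move=> y0; rewrite /beta imag_den //.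
have -> : 1 + 'i * (Complex 0 y : C) = (1 - y)%:C.
  by apply/eqP; rewrite eq_complex /=; apply/andP; split; apply/eqP; ring.
have y1 : 0 < 1 + y by lra.
rewrite cabsM cabsV !cabs_real (gtr0_norm y1) ltr_pdivrMr // mul1r ltr_norml.
by apply/andP; split; lra.
Qed.

Lemma norm2_imag (p q : RR) : norm2 (0, p) (0, q) <= `|p| + `|q|.
Proof.
have cE (y : RR) : Cabs (0, y) = `|y|.
  by rewrite toC_abs /toC /cabs /= expr0n /= add0r sqrtr_sqr.
have p0 := normr_ge0 p; have q0 := normr_ge0 q.
rewrite /norm2 !cE // RsqrtE !RpowE RplusE -(ler_pXn2r (ltn0Sn 1)) ?nnegrE ?sqrtr_ge0 ?addr_ge0 //.
rewrite sqr_sqrtr ?addr_ge0 ?sqr_ge0 //; nra.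
Qed.

(** The points [('i l s, 'i s)] approach 0 non-tangentially for each fixed [l > 0]. There [Nc / Dc]
    is [g_tau], and [Pc] is the Taylor polynomial read in the chart. *)
Lemma BJ_chart : exists Pc, forall l : RR, 0 < l ->
  exists e M : RR, 0 < e /\ forall s : RR, 0 < s < e ->
    ev l%:C ('i * s%:C) Dc != 0 ->
    cabs (ev l%:C ('i * s%:C) (Nc - Pc * Dc)) <=
    M * s ^+ (2 * J - 1)%coq_nat * cabs (ev l%:C ('i * s%:C) Dc).
Proof.
have [_ [rho rhoP]] := BJ.
exists (taylor_chart (2 * J - 2)%coq_nat rho) => l l0.
(* The sum [1 / (l s) + 1 / s] equals both [(1 + l) / (l s)] and [(1 + 1 / l) / s], so [c] covers
   either value of the minimum. *)
pose c := (1 + l) + (1 + l^-1).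
have li0 : 0 < l^-1 by rewrite invr_gt0.
have c0' : 0 < c by rewrite /c; lra.
have [de [M [/RltP de0 h]]] := rhoP c (elimT RltP c0').
(* The factors [l + 1] come from the bound [(l + 1) s] on the norm of the point. *)
exists (de / (l + 1)), (`|M| * (l + 1) ^+ (2 * J - 1)%coq_nat); split.
  by rewrite divr_gt0 //; lra.
move=> s /andP[s0]; rewrite ltr_pdivlMr; last lra.
move=> sde D0.
pose w1 : Cx := (0, l * s); pose w2 : Cx := (0, s).
have ls0 : 0 < l * s by rewrite mulr_gt0.
have w1E : toC w1 = l%:C * ('i * s%:C).
  by apply/eqP; rewrite eq_complex /=; apply/andP; split; apply/eqP; ring.
have w2E : toC w2 = 'i * s%:C.
  by apply/eqP; rewrite eq_complex /=; apply/andP; split; apply/eqP; ring.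
have nw : norm2 w1 w2 <= (l + 1) * s.
  by apply: le_trans (norm2_imag _ _) _; rewrite !gtr0_norm //; lra.
have inv_im (y : RR) : 0 < y -> Cinv (0, y) = (0, - y^-1).
  move=> y0; apply: toC_inj; rewrite toCV /toC /=; apply/eqP.
  rewrite eq_complex /=; apply/andP; split; apply/eqP; first by rewrite mul0r.
  by rewrite expr0n /= add0r; field; rewrite gt_eqF.
have nn0 : 0 <= norm2 w1 w2 by rewrite /norm2 RsqrtE sqrtr_ge0.
have nd : norm2 w1 w2 < de by apply: le_lt_trans nw _; rewrite mulrC.
have nc : norm2 (Cinv w1) (Cinv w2) <=
    Rmult c (Rmin (Ropp (Cim (Cinv w1))) (Ropp (Cim (Cinv w2)))).
  rewrite !inv_im // /Cim /= RminE !RoppE !opprK RmultE.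
  apply: le_trans (norm2_imag _ _) _; rewrite !normrN !gtr0_norm ?invr_gt0 //.
  have si0 : 0 < s^-1 by rewrite invr_gt0.
  have -> : (l * s)^-1 = l^-1 * s^-1 by rewrite invfM.
  have ll : l * l^-1 = 1 by rewrite mulfV // gt_eqF.
  have lsi : 0 < l^-1 * s^-1 by rewrite mulr_gt0.
  have lsE : l * (l^-1 * s^-1) = s^-1 by rewrite mulrA ll mul1r.
  have q1 : 0 < l^-1 * (l^-1 * s^-1) by rewrite mulr_gt0.
  have q2 : 0 < l * s^-1 by rewrite mulr_gt0.
  by rewrite /c; move: (l^-1) (s^-1) si0 lsi lsE q1 q2 => L S *; case: (leP (L * S) S) => _; lra.
have /RleP := h w1 w2 (elimT RltP ls0) (elimT RltP s0) (elimT RltP nd) (elimT RleP nc).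
rewrite toC_abs toCB -(ev_taylor_chart _ _ w1E w2E) RmultE RpowE.
set x := 'i * s%:C in w1E w2E D0 *; set T := ev _ _ (taylor_chart _ _).
have xE : x = Complex 0 s by rewrite -w2E.
have lxE : l%:C * x = Complex 0 (l * s) by rewrite -w1E.
have d1 : 1 - 'i * (l%:C * x) != 0.
  by rewrite lxE imag_den // eq_complex /= eqxx andbT gt_eqF //; lra.
have d2 : 1 - 'i * x != 0.
  by rewrite xE imag_den // eq_complex /= eqxx andbT gt_eqF //; lra.
have [FE FcE] := ev_chart_conj2 (toCa a) t1_unit t2_unit c0_conj d1 d2.
set A := c0 * _ * _ in FE FcE; set z1 := toC t1 * _ in FE FcE; set z2 := toC t2 * _ in FE FcE.
set p := ev z2 z1 (pol m n (toCa a)) in FE; set q := ev z2 z1 _ in FcE.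
have A0 : A != 0 by rewrite !mulf_neq0 ?expf_neq0.
have p0 : p != 0.
  apply: (no_zeros_ev nz); rewrite cabsM ?t1_unit ?t2_unit mul1r ?lxE ?xE.
    exact: imag_beta.
  exact: imag_beta.
have DE : ev l%:C x Dc = A * (p + q) by rewrite evD FE FcE mulrDr.
have NE : ev l%:C x Nc = 'i * (A * (p - q)).
  by rewrite evM ev_const2 evD evN FE FcE -mulrBr.
have pq0 : p + q != 0 by move: D0; rewrite DE mulf_eq0 negb_or => /andP[].
have gE : toC (g_tau m n a t1 t2 w1 w2) = 'i * ((p - q) / (p + q)).
  rewrite /g_tau toCM toC_div toCB toCD toC1 toCi /phi toC_div toC_ptilde toC_peval.
  rewrite (toCM t1) (toCM t2) !toC_beta w1E w2E -/z1 -/z2 -/p -/q.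
  have -> : 1 - q / p = (p - q) / p by field.
  have -> : 1 + q / p = (p + q) / p by field.
  by rewrite invf_div; congr (_ * _); field; rewrite p0 pq0.
have HE : ev l%:C x (Nc - taylor_chart (2 * J - 2)%coq_nat rho * Dc) =
    (toC (g_tau m n a t1 t2 w1 w2) - T) * ev l%:C x Dc.
  by rewrite [LHS]evD evN [ev _ _ (taylor_chart _ _ * _)]evM NE -/T gE DE; field.
move=> gT; rewrite HE cabsM ler_wpM2r ?cabs_ge0 //; apply: le_trans gT _.
rewrite -mulrA -exprMn.
apply: le_trans (_ : `|M| * norm2 w1 w2 ^+ (2 * J - 1)%coq_nat <= _).
  by rewrite ler_wpM2r ?ler_norm // exprn_ge0.
by rewrite ler_wpM2l ?normr_ge0 // lerXn2r ?nnegrE // (le_trans nn0 nw).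
Qed.

End CoreBridge.
End Bridge.

(** * Exchange of the two variables *)

Section Swap.
Variable R : rcfType.
Local Notation C := R[i].

Lemma chart_swap (D D' Dh : {poly {poly C}}) d :
  (forall l x, l != 0 -> ev l x D' = ev l^-1 (l * x) D) ->
  D = 'X^d * Dh -> Dh`_0 != 0 -> (size (Dh`_0)%R <= 1)%N -> (0 < d)%N ->
  exists2 Dh', D' = 'X^d * Dh' & (1 < size (Dh'`_0)%R)%N.
Proof.
move=> swap DE Dh0 /size1_polyC cE d0.
have coefE k l : l != 0 -> (D'`_k).[l] = (D`_k).[l^-1] * l ^+ k.
  move=> l0; pose g := slice l^-1 D.
  have fE : slice l D' = \poly_(i < size g) (g`_i * l ^+ i).
    apply: poly_ext => x; rewrite -ev_is_map swap // ev_is_map -/g [LHS]horner_coef [RHS]horner_poly.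
    by apply: eq_bigr => i _; rewrite exprMn mulrA.
  have := congr1 (fun p : {poly C} => p`_k) fE; rewrite coef_map coef_poly /= {1}/horner_eval => ->.
  have -> : (D`_k).[l^-1] = g`_k by rewrite coef_map.
  by case: ltnP => // gk; rewrite nth_default // mul0r.
pose nk (k : nat) : C := k.+1%:R.
have nk_inj : injective nk by move=> k l /eqP; rewrite eqr_nat eqSS => /eqP.
have nk0 k : nk k != 0 by rewrite pnatr_eq0.
have D'0 k : (k < d)%N -> D'`_k = 0.
  move=> kd; apply: (poly_eq0_inj_roots nk_inj) => j.
  by rewrite coefE // DE coefXnM kd horner0 mul0r.
have D'd : D'`_d = (Dh`_0)`_0 *: 'X^d.
  apply/eqP; rewrite -subr_eq0; apply/eqP; apply: (poly_eq0_inj_roots nk_inj) => j.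
  rewrite hornerD hornerN coefE // DE coefXnM ltnn subnn hornerZ hornerXn.
  by rewrite [in X in X - _]cE hornerC subrr.
exists (drop_poly d D').
  rewrite -{1}(poly_take_drop d D') mulrC [X in X + _](_ : _ = 0) ?add0r //.
  by apply/polyP => i; rewrite coef_take_poly coef0; case: ifP => // /D'0.
rewrite coef_drop_poly D'd size_scale ?size_polyXn //.
by move: Dh0; rewrite cE polyC_eq0 coefC.
Qed.

Lemma halfplane_poly_trans m n (a : nat -> nat -> C) t1 t2 c0 w1 w2 :
  halfplane_poly n m (transpose a) t2 t1 c0 w2 w1 = halfplane_poly m n a t1 t2 c0 w1 w2.
Proof.
rewrite /halfplane_poly exchange_big; apply: eq_bigr => i _; apply: eq_bigr => j _.
by rewrite /transpose; ring.
Qed.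

Lemma ev_chart_trans m n (a : nat -> nat -> C) t1 t2 c0 l x : l != 0 ->
  ev l x (chart n m (transpose a) t2 t1 c0) = ev l^-1 (l * x) (chart m n a t1 t2 c0).
Proof. by move=> l0; rewrite !ev_chart halfplane_poly_trans mulrA mulVf // mul1r. Qed.

Lemma ev_Dc_trans m n (a : nat -> nat -> C) t1 t2 c0 l x : l != 0 ->
  let F := chart m n a t1 t2 c0 in let F' := chart n m (transpose a) t2 t1 c0 in
  ev l x (F' + conj2 F') = ev l^-1 (l * x) (F + conj2 F).
Proof.
move=> l0 F F'; rewrite evD [RHS]evD !ev_conj2; congr (_ + _^*).
  exact: ev_chart_trans.
by rewrite ev_chart_trans ?conjc_eq0 // conjc_inv rmorphM.
Qed.

End Swap.

(** * Choice of the chart and conclusion *)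

Section Final.
Local Notation RR := Rdefinitions.R.
Local Notation C := (complex RR).

(** If [s] is a square root of [k], then [c = conj(s)] works, since [s = conj(s) s^2] on the
    circle. *)
Lemma sqrt_conj (k : C) : cabs k = 1 -> exists2 c : C, c != 0 & c^* = c * k.
Proof.
move=> k1; pose s := sqrtc k; have s2 : s ^+ 2 = k := sqr_sqrtc k.
have s1 : cabs s = 1.
  have : cabs s ^+ 2 = 1 by rewrite -cabsX s2.
  by move/eqP; rewrite sqrf_eq1 => /orP[/eqP //|/eqP h]; have := cabs_ge0 s; lra.
have s0 : s != 0 by rewrite -cabs_gt0 s1.
exists s^*; first by rewrite conjc_eq0.
by rewrite conjcK (conj_unit s1) -s2; field.
Qed.

Lemma singularity_ev m n a t1 t2 : is_singularity m n a t1 t2 ->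
  [/\ cabs (toC t1) = 1, cabs (toC t2) = 1 & ev (toC t2) (toC t1) (pol m n (toCa a)) = 0].
Proof. by move=> [h1 [h2 h3]]; rewrite -!toC_abs -toC_peval h3. Qed.

Lemma core_local_exponent m n a t1 t2 J c0 Dh d :
  no_zeros_in_bidisk m n a -> atoral m n a -> is_singularity m n a t1 t2 ->
  (0 < J)%N -> is_BJ_point J m n a t1 t2 ->
  c0 != 0 -> c0^* = c0 * toC t1 ^+ m * toC t2 ^+ n ->
  let F := chart m n (toCa a) (toC t1) (toC t2) c0 in
  F + conj2 F = 'X^d * Dh -> (1 < size (Dh`_0)%R)%N ->
  exists2 K : nat, (2 * J <= K)%N & local_exponent (Defs.eps1 m n a) t2 (INR K).
Proof.
move=> nz at_ sg J0 bj c00 c0E F DE Dh1; have [h1 h2 h3] := singularity_ev sg.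
have [Pc PcP] := BJ_chart nz h1 h2 c00 c0E bj.
have [K [c1 [c2 [e [kK c10 c20 e0 KP]]]]] :=
  contact_exponent (no_zeros_ev nz) (atoral_ev at_) h1 h2 h3 c00 DE Dh1 PcP.
(* The exponent is at least [(2 * J - 1).+1]; the truncated subtraction is exact because [J > 0]. *)
have JK : (2 * J <= K)%N.
  by apply: leq_trans kK; rewrite -[(2 * J - 1)%coq_nat]/(2 * J - 1)%N subn1 prednK // muln_gt0.
exists K => //; split.
  by apply: lt_0_INR; apply/ssrnat.ltP; apply: leq_trans JK; rewrite muln_gt0.
exists c1, c2, e; split; first exact/RltP.
split; first exact/RltP.
split; first exact/RltP.
move=> z; rewrite !toC_abs toCB => z1 [/RltP r0 /RltP re].
rewrite cabsB in r0 re.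
have [|ns [w0 [Qw0 w0max /andP[lo hi]]]] := KP (toC z) z1; first by rewrite r0.
exists (1 - cabs w0); split.
  right; split; first by case=> w [w1 [_ Pw]]; move: (ns (toC w)); rewrite -toC_abs -toC_peval Pw eqxx => /(_ w1).
  split.
    exists (ofC w0); split; last by rewrite toC_abs ofCK.
    by apply: toC_inj; rewrite toC_ptilde ofCK.
  move=> w Qw; apply/RleP; rewrite toC_abs; apply: lerB => //.
  by apply: w0max; rewrite -toC_ptilde Qw.
rewrite cabsB Rpower_pow; last exact/RltP.
by rewrite !RmultE !RpowE; split; apply/RleP.
Qed.

Theorem contact_order_ge m n a t1 t2 J :
  no_zeros_in_bidisk m n a -> atoral m n a -> is_singularity m n a t1 t2 ->
  (1 <= J)%coq_nat -> is_BJ_point J m n a t1 t2 ->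
  exists2 K : nat, (2 * J <= K)%coq_nat &
    local_exponent (Defs.eps1 m n a) t2 (INR K) \/ local_exponent (Defs.eps2 m n a) t1 (INR K).
Proof.
move=> nz at_ sg /ssrnat.leP J0 bj; have [h1 h2 h3] := singularity_ev sg.
have [|c0 c00 c0E] := @sqrt_conj (toC t1 ^+ m * toC t2 ^+ n).
  by rewrite cabsM !cabsX h1 h2 !expr1n mulr1.
rewrite mulrA in c0E.
have c0E' : c0^* = c0 * toC t2 ^+ n * toC t1 ^+ m by rewrite c0E mulrAC.
have D0 := Dc_neq0 (no_zeros_ev nz) (atoral_ev at_) h1 h2 h3 c00 c0E.
have [d [Dh DE Dh0]] := poly_factor_X D0.
have [Dh1|Dh1] := ltnP 1 (size (Dh`_0)%R).
  have [K JK KP] := core_local_exponent nz at_ sg J0 bj c00 c0E DE Dh1.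
  by exists K; [exact/ssrnat.leP | left].
have d0 : (0 < d)%N.
  rewrite lt0n; apply: contra_neqN Dh0 => /eqP d0.
  apply: (poly_eq0_inj_roots (@natr_inj RR)) => k.
  have one0 : 1 - 'i * (0 : C) != 0 by rewrite mulr0 subr0 oner_neq0.
  have one0' : 1 - 'i * (k%:R * 0 : C) != 0 by rewrite mulr0.
  have [FE FcE] := ev_chart_conj2 (toCa a) h1 h2 c0E one0' one0.
  have b0 : beta (0 : C) = 1 by rewrite /beta mulr0 addr0 subr0 divr1.
  move: FE FcE; rewrite mulr0 b0 !mulr1 h3 mulr0 => FE.
  rewrite ev_refl //; last by rewrite -cabs_gt0 h1.
  rewrite (conj_unit h1) invrK h3 rmorph0 !mulr0 => FcE.
  have DhE : Dh = 'X^d * Dh by rewrite d0 expr0 mul1r.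
  by rewrite -ev0 DhE -DE evD FE FcE mulr0 addr0.
have [Dh' DE' Dh1'] := chart_swap (fun l x => @ev_Dc_trans RR m n (toCa a) _ _ c0 l x) DE Dh0 Dh1 d0.
have [K JK KP] := core_local_exponent (no_zeros_trans nz) (atoral_trans at_)
  (proj1 (singularity_trans m n a t1 t2) sg) J0 (BJ_trans bj) c00 c0E' DE' Dh1'.
by exists K; [exact/ssrnat.leP | right; apply: local_exponent_trans].
Qed.

End Final.


End ContactOrder.

Theorem theorem7p1 :
  forall (m n : nat) (a : nat -> nat -> Cx) (t1 t2 : Cx) (J : nat),
    has_bidegree m n a ->
    no_zeros_in_bidisk m n a ->
    atoral m n a ->
    is_singularity m n a t1 t2 ->
    (1 <= J)%nat ->
    is_BJ_point J m n a t1 t2 ->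
    forall K1 K2 : R,
      is_contact_order1 m n a K1 ->
      is_contact_order2 m n a K2 ->
      2 * INR J <= Rmax K1 K2.
Proof.
intros m n a t1 t2 J _ nz at_ sg J1 bj K1 K2 [_ max1] [_ max2].
destruct (ContactOrder.contact_order_ge nz at_ sg J1 bj) as [K JK [le1|le2]].
- apply Rle_trans with (INR K).
  + replace 2 with (INR 2) by reflexivity; rewrite <- mult_INR; exact (le_INR _ _ JK).
  + apply Rle_trans with K1; [|apply Rmax_l].
    apply max1 with t2; [now exists t1 | exact le1].
- apply Rle_trans with (INR K).
  + replace 2 with (INR 2) by reflexivity; rewrite <- mult_INR; exact (le_INR _ _ JK).
  + apply Rle_trans with K2; [|apply Rmax_r].
    apply max2 with t1; [now exists t2 | exact le2].
Qed.
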